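(* There exists $N\in\mathbb{N}$ such that for any finite symmetric set $S\subset \mathrm{SA}(2,\mathbb{Z})$ containing $1$ and generating a non-virtually solvable subgroup $\Gamma$ which does not have a global fixed point in $\mathbb{Q}^2$, the set $S^N$ contains two elements freely generating a non-abelian free group $\mathrm{F}_2$ whose natural action on $\mathbb{R}^2$ is locally commutative.
   Context: $\mathrm{SA}(2,\mathbb{Z})=\mathrm{SL}(2,\mathbb{Z})\ltimes\mathbb{Z}^2$, acting on $\mathbb{R}^2$ by affine transformations: $g=(\theta(g),\tau(g))$ acts by $gx=\theta(g)x+\tau(g)$. A set $S$ is symmetric if $S^{-1}=S$. $S^N=\{s_1\cdots s_N : s_i\in S\}$. A group action on a set is locally commutative if the stabilizer of every point is commutative (equivalently, any two group elements with a common fixed point commute). A global fixed point of $\Gamma$ is a point fixed by every element of $\Gamma$. *)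

(* Defs.v *)
From HB Require Import structures.
From mathcomp Require Import all_boot all_order all_algebra.
From mathcomp Require Import boolp classical_sets cardinality reals.

Set Implicit Arguments.
Unset Strict Implicit.
Unset Printing Implicit Defensive.

Import GRing.Theory.

Local Open Scope classical_set_scope.
Local Open Scope group_scope.

Section Groups.
Variable G : groupType.
Implicit Types (S H K : set G) (a b x y : G).

Definition is_subgroup H : Prop :=
  [/\ H 1,
      (forall x y, H x -> H y -> H (x * y)) &
      (forall x, H x -> H x^-1)].

Definition generated S : set G := smallest is_subgroup S.

Definition symmetric_set S : Prop := [set x^-1 | x in S] = S.

Definition setpow S (N : nat) : set G :=
  [set g | exists s : 'I_N -> G,
     (forall i, S (s i)) /\ g = \prod_(i < N) s i].

Definition derived H : set G :=
  generated [set g | exists x y, [/\ H x, H y & g = [~ x, y]]].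

Definition solvable_subgroup H : Prop := exists n, iter n derived H = [set 1].

Definition finite_index H K : Prop :=
  finite_set [set [set x * h | h in K] | x in H].

Definition virtually_solvable H : Prop :=
  exists K, [/\ is_subgroup K, K `<=` H, finite_index H K & solvable_subgroup K].

(* A word is a sequence of letters (i, e): i selects the generator (a if true,
   b if false) and e tells whether it is inverted. *)
Definition letter_val a b (l : bool * bool) : G :=
  let g := if l.1 then a else b in if l.2 then g^-1 else g.

Definition word_val a b (w : seq (bool * bool)) : G :=
  \prod_(l <- w) letter_val a b l.

Definition not_inverse_letters (l m : bool * bool) : bool :=
  ~~ ((l.1 == m.1) && (l.2 != m.2)).

Definition reduced (w : seq (bool * bool)) : bool :=
  sorted not_inverse_letters w.

(* In particular a != b, so <a, b> is free of rank exactly 2. *)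
Definition freely_generate a b : Prop :=
  forall w, reduced w -> w <> [::] -> word_val a b w <> 1.

Section Actions.
Variables (X : Type) (act : G -> X -> X).

Definition stabilizer H (p : X) : set G := [set g | H g /\ act g p = p].

Definition locally_commutative H : Prop :=
  forall p x y, stabilizer H p x -> stabilizer H p y -> commute x y.

Definition global_fixed_point H (p : X) : Prop :=
  forall g, H g -> act g p = p.

End Actions.
End Groups.

Local Open Scope ring_scope.

(* SA(2, Z), as pairs (theta, tau) with theta in SL(2, Z) and tau in Z^2. *)
Record SA2Z : Type := MkSA2Z {
  SA2Z_val : 'M[int]_2 * 'cV[int]_2;
  SA2Z_prop : \det SA2Z_val.1 == 1
}.

HB.instance Definition _ := [isSub for SA2Z_val].
HB.instance Definition _ := [Choice of SA2Z by <:].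

Definition theta (g : SA2Z) : 'M[int]_2 := (SA2Z_val g).1.
Definition tau (g : SA2Z) : 'cV[int]_2 := (SA2Z_val g).2.

Lemma det_theta g : \det (theta g) = 1.
Proof. exact/eqP/SA2Z_prop. Qed.

Lemma theta_unit g : theta g \in unitmx.
Proof. by rewrite unitmxE det_theta unitr1. Qed.

Lemma SA2Z_eq g h : theta g = theta h -> tau g = tau h -> g = h.
Proof.
by move=> e1 e2; apply: val_inj; apply: injective_projections.
Qed.

Fact SA2Z_mul_subproof g h : \det (theta g *m theta h) == 1.
Proof. by rewrite det_mulmx !det_theta mulr1. Qed.

Fact SA2Z_one_subproof : \det (1%:M : 'M[int]_2) == 1.
Proof. by rewrite det1. Qed.

Fact SA2Z_inv_subproof g : \det (invmx (theta g)) == 1.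
Proof. by rewrite det_inv det_theta invr1. Qed.

Definition SA2Z_mul g h : SA2Z :=
  @MkSA2Z (theta g *m theta h, theta g *m tau h + tau g)
    (SA2Z_mul_subproof g h).

Definition SA2Z_one : SA2Z := @MkSA2Z (1%:M, 0) SA2Z_one_subproof.

Definition SA2Z_inv g : SA2Z :=
  @MkSA2Z (invmx (theta g), - (invmx (theta g) *m tau g))
    (SA2Z_inv_subproof g).

Fact SA2Z_mulA : associative SA2Z_mul.
Proof.
move=> f g h; apply: SA2Z_eq; rewrite /theta /tau /= ?mulmxA //.
by rewrite mulmxDr mulmxA addrA.
Qed.

Fact SA2Z_mul1 : left_id SA2Z_one SA2Z_mul.
Proof.
by move=> g; apply: SA2Z_eq; rewrite /theta /tau /= !mul1mx ?addr0.
Qed.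

Fact SA2Z_mulr1 : right_id SA2Z_one SA2Z_mul.
Proof.
by move=> g; apply: SA2Z_eq; rewrite /theta /tau /= ?mulmx1 ?mulmx0 ?add0r.
Qed.

Fact SA2Z_mulV : left_inverse SA2Z_one SA2Z_inv SA2Z_mul.
Proof.
move=> g; apply: SA2Z_eq; first exact: mulVmx (theta_unit g).
exact: subrr.
Qed.

Fact SA2Z_mulrV : right_inverse SA2Z_one SA2Z_inv SA2Z_mul.
Proof.
move=> g; apply: SA2Z_eq; first exact: mulmxV (theta_unit g).
rewrite [LHS]/(theta g *m - (invmx (theta g) *m tau g) + tau g).
by rewrite mulmxN mulmxA (mulmxV (theta_unit g)) mul1mx; exact: addNr.
Qed.

HB.instance Definition _ := isGroup.Build SA2Z
  SA2Z_mulA SA2Z_mul1 SA2Z_mulr1 SA2Z_mulV SA2Z_mulrV.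

Definition affine_act (K : comNzRingType) (g : SA2Z) (x : 'cV[K]_2) : 'cV[K]_2 :=
  map_mx intr (theta g) *m x + map_mx intr (tau g).

Lemma affine_act1 (K : comNzRingType) (x : 'cV[K]_2) : affine_act 1%g x = x.
Proof. by rewrite /affine_act /theta /tau /= map_mx1 mul1mx map_mx0 addr0. Qed.

Lemma affine_actM (K : comNzRingType) (g h : SA2Z) (x : 'cV[K]_2) :
  affine_act (g * h)%g x = affine_act g (affine_act h x).
Proof.
by rewrite /affine_act /= map_mxM map_mxD map_mxM mulmxDr !mulmxA addrA.
Qed.

(* Main.v *)
Require Import Defs.
From HB Require Import structures.
From mathcomp Require Import all_boot all_order all_algebra.
From mathcomp Require Import boolp classical_sets cardinality reals.
From mathcomp Require Import ring lra zify.

(** The point is to find a, b among the short products of S such that the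
    affine plane carries a height function phi that is increased by almost every
    letter a, a^-1, b, b^-1: far from the origin at most one letter fails to
    increase phi, and at most two letters keep a bounded point bounded.

    This is enough.  A reduced closed path cannot leave the bounded region, since
    after leaving it the height grows forever; and inside the region the paths
    have no choice of direction, so that all the loops at a point are powers of
    one loop up to free reduction.  Hence stabilizers are commutative, and
    freeness follows as well, because a relation would be a loop at every point,
    also at the far ones (pingpong_locally_commutative, pingpong_freely_generate).

    Suppose that a is diagonal with eigenvalues M and 1/M around its fixed point,
    and let b = h a h^-1.  For phi the maximum of the two coordinates, a letter
    fails to increase phi only in a thin strip around one of the two axes of a,
    or of b.  Two such strips meet in a bounded region, and no three of them
    meet provided that the fixed point of each map stays away from the axes of the
    other one (two_strips, three_strips).  For that, M has only to be large
    compared with a bound D for the entries of h, of h(0) and of h^-1(0) and for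
    their inverses.

    The uniformity comes from arithmetic.  Among the products of 6 elements of S
    take a0 of maximal trace, T in absolute value; T >= 3, since otherwise the
    linear parts commute and the group is solvable (exists_hyperbolic).  Pick a
    product g of at most two elements of S that moves both the pair of axes and
    the fixed point of a0; if there were none, the group would be virtually
    solvable or have a fixed rational point (exists_transverse).  Write the linear
    part of g as (al, be; ga, de) in eigencoordinates of a0.  Maximality and the
    trace identities bound al and de by T^5 (exists_maximal_hyperbolic), and
    al de and be ga are nonzero rational numbers with denominator T^2 - 4.  The
    coordinates can be rescaled so that be and ga have the same size and the
    translation part v of g has norm 1.  All four entries then lie between 1/C
    and C, where C = L^16 for the eigenvalue L of a0 of modulus at least 1.

    Still v may lie very close to an axis of a0.  With h = g a0^n g for a suitable
    n of either sign this is no longer harmful: a large multiple of a column of the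
    linear part of g dominates h(0), unless v is nearly contracted by a0^n, and
    likewise for h^-1(0); both signs of n cannot fail simultaneously
    (hyperbolic_pingpong).  A power of a0 then serves as a. *)

Set Implicit Arguments.
Unset Strict Implicit.
Unset Printing Implicit Defensive.

Import Order.TTheory GRing.Theory Num.Theory.

Local Open Scope classical_set_scope.
Local Open Scope ring_scope.

(** * Words read as paths *)

Section PathWords.
Variables (G : groupType) (a b : G).
Local Notation letter := (bool * bool)%type.
Implicit Types (l m : letter) (u v w : seq letter).

Definition inv_letter l : letter := (l.1, ~~ l.2).
Definition inv_word w := rev (map inv_letter w).

(** A path is read in the order in which its letters act on a point, whereas the
    last letter of a word acts first. *)
Fixpoint path_val w : G :=
  if w is l :: w' then (path_val w' * letter_val a b l)%g else 1%g.

Lemma inv_letterK : involutive inv_letter.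
Proof. by case=> i e; rewrite /inv_letter /= negbK. Qed.

Lemma not_inverse_lettersE l m : not_inverse_letters l m = (m != inv_letter l).
Proof. by case: l m => [[] []] [[] []]. Qed.

Lemma inv_letter_neq l : inv_letter l != l.
Proof. by case: l => [[] []]. Qed.

Lemma inv_letter_eq l m : (m == inv_letter l) = (l == inv_letter m).
Proof. by case: l m => [[] []] [[] []]. Qed.

Lemma not_inverse_letters_sym : symmetric not_inverse_letters.
Proof. by move=> l m; rewrite !not_inverse_lettersE inv_letter_eq. Qed.

Lemma letter_val_inv l : letter_val a b (inv_letter l) = (letter_val a b l)^-1%g.
Proof. by case: l => [[] []]; rewrite /letter_val //= invgK. Qed.

Lemma path_val_cat u v : path_val (u ++ v) = (path_val v * path_val u)%g.
Proof. by elim: u => [|l u IH] /=; rewrite ?mulg1 // IH mulgA. Qed.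

Lemma path_val_rev w : path_val (rev w) = word_val a b w.
Proof.
elim: w => [|l w IH]; first by rewrite /word_val big_nil.
by rewrite rev_cons -cats1 path_val_cat IH /word_val big_cons /= mul1g.
Qed.

Lemma path_val_inv w : path_val (inv_word w) = (path_val w)^-1%g.
Proof.
elim: w => [|l w IH]; first by rewrite invg1.
by rewrite /inv_word /= rev_cons -cats1 path_val_cat IH /= mul1g
  letter_val_inv invgM.
Qed.

Lemma reduced_rev w : reduced (rev w) = reduced w.
Proof.
rewrite /reduced rev_sorted; apply: eq_sorted => l m.
exact: not_inverse_letters_sym.
Qed.

Lemma reduced_inv w : reduced (inv_word w) = reduced w.
Proof.
rewrite reduced_rev /reduced sorted_map; apply: eq_sorted => l m /=.
by rewrite !not_inverse_lettersE (inj_eq (can_inj inv_letterK)).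
Qed.

Lemma reduced_cons l m w :
  reduced [:: l, m & w] = (m != inv_letter l) && reduced (m :: w).
Proof. by rewrite /reduced /= not_inverse_lettersE. Qed.

Lemma reduced_tail l w : reduced (l :: w) -> reduced w.
Proof. by case: w => // m w; rewrite reduced_cons => /andP[]. Qed.

Lemma reduced_cat u v : reduced (u ++ v) -> reduced u /\ reduced v.
Proof.
rewrite /reduced; case: u => //= l u; rewrite cat_path => /andP[-> /path_sorted].
by [].
Qed.

Lemma reduced_rcons2 u l m : reduced (rcons (rcons u l) m) -> m != inv_letter l.
Proof.
by rewrite -!cats1 -catA => /reduced_cat[_]; rewrite reduced_cons => /andP[].
Qed.

Lemma free_reduction w : exists2 v, reduced v & path_val v = path_val w.
Proof.
elim: w => [|l w [v red_v v_w]]; first by exists [::].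
case: v red_v v_w => [|m v] red_v v_w; first by exists [:: l]; rewrite //= -v_w.
have [m_l|m_l] := eqVneq m (inv_letter l); last first.
  by exists [:: l, m & v]; rewrite ?reduced_cons ?m_l //= -v_w.
exists v; first exact: reduced_tail red_v.
by rewrite /= -v_w /= m_l letter_val_inv mulgVK.
Qed.

Lemma generated_path_val g :
  generated [set a; b] g -> exists2 w, reduced w & g = path_val w.
Proof.
move=> gen_g.
suff : (range path_val) g.
  by case=> w _ <-; have [v] := free_reduction w; exists v.
apply: gen_g; split; last first.
  by move=> _ [->|->]; [exists [:: (true, false)]|exists [:: (false, false)]];
    rewrite //= mul1g.
split; first by exists [::].
- by move=> _ _ [u _ <-] [v _ <-]; exists (v ++ u); rewrite ?path_val_cat.
- by move=> _ [u _ <-]; exists (inv_word u); rewrite ?path_val_inv.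
Qed.

Lemma cyclic_reduction w : reduced w -> w <> [::] ->
  (exists l u, [/\ w = l :: rcons u (inv_letter l), reduced u & u <> [::]]) \/
  exists l u, w = l :: u /\ last l u != inv_letter l.
Proof.
case: w => // l w red_w _; have [last_w|] := eqVneq (last l w) (inv_letter l);
  last by move=> ?; right; exists l, w.
case/lastP: w red_w last_w => [|u m] red_w /=.
  by move/esym/eqP; rewrite (negPf (inv_letter_neq l)).
rewrite last_rcons => m_l; rewrite {m}m_l in red_w *; left; exists l, u.
split=> // [|u0].
  by move: (reduced_tail red_w); rewrite -cats1 => /reduced_cat[].
by move: red_w; rewrite u0 reduced_cons eqxx.
Qed.

End PathWords.

(** * Ping-pong for locally commutative actions *)

Section PingPong.
Variables (F : realDomainType) (G : groupType) (X : Type) (act : G -> X -> X).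
Variables (a b : G) (phi : X -> F) (r : F).
Local Notation letter := (bool * bool)%type.
Implicit Types (l m : letter) (u v w : seq letter) (x p q : X).

Local Notation step l x := (act (letter_val a b l) x).
Local Notation val := (path_val a b).

(** Such a step neither climbs nor leaves the region phi <= r. *)
Definition nonescaping l x : bool := phi (step l x) <= Num.max (phi x) r.

Hypothesis act1 : forall x, act 1%g x = x.
Hypothesis actM : forall g h x, act (g * h)%g x = act g (act h x).
Hypothesis nonescaping2 : forall l m x, l != m ->
  nonescaping l x -> nonescaping m x -> phi x <= r.
Hypothesis nonescaping3 : forall l m n x, uniq [:: l; m; n] ->
  ~ [/\ nonescaping l x, nonescaping m x & nonescaping n x].

Lemma step_invK l x : step (inv_letter l) (step l x) = x.
Proof. by rewrite -actM letter_val_inv mulVg act1. Qed.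

Lemma step_invKV l x : step l (step (inv_letter l) x) = x.
Proof. by rewrite -actM letter_val_inv mulgV act1. Qed.

Lemma end_cons l w x : act (val (l :: w)) x = act (val w) (step l x).
Proof. by rewrite /= actM. Qed.

Lemma end_cat u v x : act (val (u ++ v)) x = act (val v) (act (val u) x).
Proof. by rewrite path_val_cat actM. Qed.

Lemma end_rcons u l x : act (val (rcons u l)) x = step l (act (val u) x).
Proof. by rewrite -cats1 end_cat end_cons /= act1. Qed.

(** Once a reduced path has escaped, going back is the only nonescaping step,
    and a reduced path never takes it: the height grows forever. *)
Lemma escape l w p : reduced (l :: w) -> ~~ nonescaping l p ->
  Num.max (phi p) r < phi (act (val (l :: w)) p).
Proof.
elim: w l p => [|m w IH] l p red_w; rewrite /nonescaping -ltNge => esc_l.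
  by rewrite end_cons act1.
move: red_w; rewrite reduced_cons => /andP[ml red_w].
set q := step l p in esc_l; have [p_q r_q] : phi p < phi q /\ r < phi q.
  by move: esc_l; rewrite gt_max => /andP[].
have back : nonescaping (inv_letter l) q.
  by rewrite /nonescaping /q step_invK le_max ltW.
have : ~~ nonescaping m q.
  by apply/negP => /(nonescaping2 ml)/(_ back); rewrite leNgt r_q.
move=> /(IH _ _ red_w) end_q; rewrite end_cons; apply: le_lt_trans end_q.
by rewrite le_max ge_max (ltW p_q) (ltW r_q).
Qed.

Fixpoint confined w x : bool :=
  (phi x <= r) && (if w is l :: w' then confined w' (step l x) else true).

Lemma confined_start w x : confined w x -> phi x <= r.
Proof. by case: w => [|? ?] /= /andP[]. Qed.

Lemma confined_cat u v x :
  confined (u ++ v) x -> confined u x /\ confined v (act (val u) x).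
Proof.
elim: u x => [|l u IH] x.
  by move=> conf; rewrite /= act1 (confined_start conf).
by rewrite cat_cons /= => /andP[-> /IH[-> ?]]; rewrite actM.
Qed.

(** A path that leaves the bounded region never comes back. *)
Lemma confined_path w p : reduced w -> phi p <= r ->
  phi (act (val w) p) <= r -> confined w p.
Proof.
elim: w p => [|l w IH] p red_w p_r end_r /=; first by rewrite p_r.
rewrite p_r; have : nonescaping l p.
  apply/negPn/negP => /(escape red_w).
  by rewrite gt_max [r < _]ltNge end_r andbF.
rewrite /nonescaping max_r // => step_r.
by apply: IH; rewrite ?(reduced_tail red_w) // -end_cons.
Qed.

Lemma confined_first l w p : confined (l :: w) p -> nonescaping l p.
Proof.
by move=> /= /andP[? /confined_start]; rewrite /nonescaping le_max orbC => ->.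
Qed.

Lemma confined_last w l p : confined (rcons w l) p ->
  nonescaping (inv_letter l) (act (val (rcons w l)) p).
Proof.
rewrite -cats1 => /confined_cat[_ /confined_start]; rewrite cats1 end_rcons.
by rewrite /nonescaping step_invK le_max orbC => ->.
Qed.

(** A loop with cancelling ends is a tail leading to a shorter loop, and the
    tail together with that loop gives three nonescaping letters where they
    meet. *)
Lemma confined_loop_cyclic l w p : reduced (l :: w) -> phi p <= r ->
  act (val (l :: w)) p = p -> last l w != inv_letter l.
Proof.
have [n] := ubnP (size w).
elim: n l w p => // n IH l w p size_w red_w p_r loop; apply/negP => /eqP last_w.
have [//|[k [u [[<- w_u] red_u u0]]]|[k [u [[<- <-]]]]] := cyclic_reduction red_w;
  last by rewrite last_w eqxx.
rewrite {w}w_u in size_w red_w loop last_w.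
set q := step l p.
have loop_q : act (val u) q = q.
  by rewrite -[LHS](step_invKV l) -end_rcons -end_cons loop.
have : confined (l :: rcons u (inv_letter l)) p by apply: confined_path; rewrite ?loop.
rewrite -cats1 -cat_cons => /confined_cat[/= /andP[_ conf_q] _].
have q_r := confined_start conf_q.
have back : nonescaping (inv_letter l) q.
  by rewrite /nonescaping /q step_invK le_max p_r orbT.
case: u u0 red_u red_w loop_q conf_q size_w {loop last_w} => // m u _ red_u red_w
  loop_q conf_q; rewrite size_rcons ltnS /= => size_u.
have cyc : last m u != inv_letter m by apply: (IH _ _ q) => //; exact: ltnW.
have m_l : m != inv_letter l by move: red_w; rewrite reduced_cons => /andP[].
have last_l : inv_letter l != inv_letter (last m u).
  move: (reduced_tail red_w); rewrite lastI; exact: reduced_rcons2.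
apply: (@nonescaping3 m (inv_letter l) (inv_letter (last m u)) q).
  by rewrite /= !inE negb_or m_l last_l inv_letter_eq cyc.
split=> //; first exact: confined_first conf_q.
by move: conf_q loop_q; rewrite lastI => /confined_last last_bad <-.
Qed.

(** The two ends of the loop are distinct and nonescaping, which leaves no room for
    a third letter. *)
Lemma confined_loop_exits l w p m : reduced (l :: w) -> phi p <= r ->
  act (val (l :: w)) p = p -> nonescaping m p ->
  m = l \/ m = inv_letter (last l w).
Proof.
move=> red_w p_r loop esc_m.
have conf : confined (l :: w) p by apply: confined_path; rewrite ?loop.
have cyc := confined_loop_cyclic red_w p_r loop.
have [|ml] := eqVneq m l; first by left.
have [|mw] := eqVneq m (inv_letter (last l w)); first by right.
case: (@nonescaping3 m l (inv_letter (last l w)) p).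
  by rewrite /= !inE negb_or ml mw inv_letter_eq cyc.
split=> //; first exact: confined_first conf.
by move: conf loop; rewrite lastI => /confined_last last_bad <-.
Qed.

(** Two confined reduced paths leaving along the same letter never diverge,
    since diverging takes a third nonescaping letter. *)
Lemma confined_paths_prefix u v l p : reduced (l :: u) -> reduced (l :: v) ->
  confined (l :: u) p -> confined (l :: v) p ->
  exists w, u = v ++ w \/ v = u ++ w.
Proof.
elim: u v l p => [|m u IH] v l p; first by exists v; right.
case: v => [|n v]; first by exists (m :: u); left.
rewrite !reduced_cons => /andP[ml red_u] /andP[nl red_v].
rewrite [confined _ _]/= => /andP[p_r conf_u].
rewrite [confined _ _]/= => /andP[_ conf_v].
have mn : m = n.
  apply/eqP/negPn/negP => mn.
  case: (@nonescaping3 m n (inv_letter l) (step l p)).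
    by rewrite /= !inE negb_or mn ml nl.
  split; [exact: confined_first conf_u|exact: confined_first conf_v|].
  by rewrite /nonescaping step_invK le_max p_r orbT.
rewrite -{n}mn in red_v conf_v nl *.
have [w [->|->]] := IH _ _ _ red_u red_v conf_u conf_v; exists w; first by left.
by right.
Qed.

(** By the previous lemma the shorter of two loops at a point of the bounded
    region is, up to inversion, an initial part of the longer one; this is a
    Euclidean algorithm on the two loops. *)
Lemma confined_loops_commute u v p : reduced u -> reduced v -> phi p <= r ->
  act (val u) p = p -> act (val v) p = p -> commute (val u) (val v).
Proof.
have [n] := ubnP (size u + size v)%N; elim: n u v => // n IH u v.
rewrite ltnS => size_uv red_u red_v p_r loop_u loop_v.
case: v => [|l v] in red_v loop_v size_uv *; first exact: commute1.
case: u => [|m u] in red_u loop_u size_uv *; first exact/commute_sym/commute1.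
have conf w : reduced w -> act (val w) p = p -> confined w p.
  by move=> ? loop_w; apply: confined_path; rewrite ?loop_w.
have quotient w1 w2 : reduced (w1 ++ w2) -> act (val w1) p = p ->
    act (val (w1 ++ w2)) p = p -> reduced w2 /\ act (val w2) p = p.
  by move=> /reduced_cat[_ ?] w1_p; rewrite end_cat w1_p.
have same_start w : reduced (l :: w) -> act (val (l :: w)) p = p ->
    ((size w).+1 + (size v).+1 <= n)%N -> commute (val (l :: w)) (val (l :: v)).
  move=> red_w loop_w size_wv.
  have [t [wt|vt]] := confined_paths_prefix red_w red_v
    (conf _ red_w loop_w) (conf _ red_v loop_v).
    rewrite wt -cat_cons in red_w loop_w *.
    have [red_t loop_t] := quotient _ _ red_w loop_v loop_w.
    rewrite path_val_cat; apply/commute_sym/commuteM; last exact: commute_refl.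
    apply/commute_sym/IH => //; move: size_wv; rewrite wt size_cat /=; lia.
  rewrite vt -cat_cons in red_v loop_v *.
  have [red_t loop_t] := quotient _ _ red_v loop_w loop_v.
  rewrite path_val_cat; apply/commuteM; last exact: commute_refl.
  apply: IH => //; move: size_wv; rewrite vt size_cat /=; lia.
have [lm|lm] := confined_loop_exits red_u p_r loop_u
    (confined_first (conf _ red_v loop_v)).
  by rewrite -lm in red_u loop_u *; apply: same_start.
have inv_u : inv_word (m :: u) = l :: inv_word (belast m u).
  by rewrite lm lastI /inv_word map_rcons rev_rcons.
rewrite -[X in commute X _]invgK -path_val_inv.
apply/commute_sym/commuteV/commute_sym; rewrite inv_u; apply: same_start.
- by rewrite -inv_u reduced_inv.
- by rewrite -inv_u path_val_inv -[in LHS]loop_u -actM mulVg act1.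
- by move: size_uv; rewrite /inv_word size_rev size_map size_belast /=.
Qed.

(** Outside the bounded region one of the two distinct ends would be escaping, and
    the loop or its inverse would never return. *)
Lemma cyclic_loop_bounded l w p : reduced (l :: w) -> last l w != inv_letter l ->
  act (val (l :: w)) p = p -> phi p <= r.
Proof.
move=> red_w cyc loop; apply: (@nonescaping2 l (inv_letter (last l w)) p).
- by rewrite inv_letter_eq.
- apply/negPn/negP => /(escape red_w); rewrite loop.
  by rewrite gt_max ltxx.
apply/negPn/negP => esc.
have inv_w : inv_word (l :: w) = inv_letter (last l w) :: inv_word (belast l w).
  by rewrite lastI /inv_word map_rcons rev_rcons.
have := escape _ esc; move=> /(_ (inv_word (belast l w))).
rewrite -inv_w reduced_inv => /(_ red_w).
by rewrite path_val_inv -[X in act _ X]loop -actM mulVg act1 gt_max ltxx.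
Qed.

(** Cancelling the two ends of a loop moves its base point, until the loop is
    cyclically reduced. *)
Lemma loop_conj_bounded w p : reduced w -> w <> [::] -> act (val w) p = p ->
  exists v, phi (act (val v) p) <= r.
Proof.
have [n] := ubnP (size w); elim: n w p => // n IH w p size_w red_w w0 loop.
have [[l [u [wu red_u u0]]]|[l [u [wu cyc]]]] := cyclic_reduction red_w w0.
  have [||v] := IH u (step l p) _ red_u u0.
  - by move: size_w; rewrite wu /= size_rcons; lia.
  - by rewrite -[LHS](step_invKV l) -end_rcons -end_cons -wu loop.
  by rewrite -end_cons => v_r; exists (l :: v).
exists [::]; rewrite act1; rewrite wu in red_w loop.
exact: cyclic_loop_bounded loop.
Qed.

Lemma pingpong_locally_commutative :
  locally_commutative act (generated [set a; b]).
Proof.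
move=> p x y [/generated_path_val[u red_u ->] loop_u].
move=> [/generated_path_val[v red_v ->] loop_v].
have [->|u0] := pselect (u = [::]); first exact/commute_sym/commute1.
have [w w_r] := loop_conj_bounded red_u u0 loop_u.
(* conjugating by w moves the base point into the bounded region *)
have conj t : act (val t) p = p -> exists t', [/\ reduced t',
    val t' = ((val t) ^ (val w)^-1)%g & act (val t') (act (val w) p) = act (val w) p].
  move=> loop_t; have [t' red_t' val_t'] := free_reduction a b (inv_word w ++ t ++ w).
  exists t'; rewrite val_t' !path_val_cat path_val_inv conjgE invgK mulgA; split=> //.
  by rewrite -actM mulgVK actM loop_t.
have [u' [red_u' val_u' loop_u']] := conj u loop_u.
have [v' [red_v' val_v' loop_v']] := conj v loop_v.
have := confined_loops_commute red_u' red_v' w_r loop_u' loop_v'.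
rewrite val_u' val_v' /commute -!conjMg; exact: conjg_inj.
Qed.

(** A trivial word is a loop at the far point x0, and so are its cyclic
    reductions. *)
Lemma pingpong_freely_generate x0 : r < phi x0 -> freely_generate a b.
Proof.
move=> r_x0.
suff free w : reduced w -> w <> [::] -> val w <> 1%g.
  move=> w red_w w0; rewrite -path_val_rev; apply: free; first by rewrite reduced_rev.
  by case: w w0 {red_w} => // l w _ /(congr1 size); rewrite size_rev.
have [n] := ubnP (size w); elim: n w => // n IH w size_w red_w w0 val_w.
have [[l [u [wu red_u u0]]]|[l [u [wu cyc]]]] := cyclic_reduction red_w w0.
  apply: (IH u) => //; first by move: size_w; rewrite wu /= size_rcons; lia.
  move: val_w; rewrite wu /= -cats1 path_val_cat /= mul1g letter_val_inv => E.
  have : (val u * letter_val a b l)%g = letter_val a b l.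
    by apply: (mulgI (letter_val a b l)^-1%g); rewrite mulgA E mulVg.
  by move=> E'; apply: (mulIg (letter_val a b l)); rewrite E' mul1g.
rewrite wu in red_w val_w.
have := @cyclic_loop_bounded _ _ x0 red_w cyc.
by rewrite val_w act1 leNgt r_x0 => /(_ erefl).
Qed.

End PingPong.

(** * Two hyperbolic affine maps of the plane *)

Section Strips.
Variables (F : realFieldType) (D e : F).
Hypotheses (D1 : 1 <= D) (e0 : 0 <= e).
Implicit Types A B c u v z : F.

Lemma norm_affine_le A B c u v : `|A| <= D -> `|B| <= D -> `|c| <= D ->
  `|u| <= e -> `|v| <= e -> `|A * u + B * v + c| <= 2 * D * e + D.
Proof.
move=> A_D B_D c_D u_e v_e.
have Au : `|A * u| <= D * e by rewrite normrM ler_pM.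
have Bv : `|B * v| <= D * e by rewrite normrM ler_pM.
have := ler_normD (A * u + B * v) c; have := ler_normD (A * u) (B * v); lra.
Qed.

Lemma norm_solve_le A B c u v : 1 <= `|A| -> `|B| <= D -> `|c| <= D ->
  `|A * u + B * v + c| <= e -> `|v| <= e -> `|u| <= 2 * D * e + D.
Proof.
move=> A_1 B_D c_D z_e v_e.
have Bv : `|B * v| <= D * e by rewrite normrM ler_pM.
have Au : `|u| <= `|A * u| by rewrite normrM ler_peMl.
have De : e <= D * e by rewrite ler_peMl.
have := ler_normB (A * u + B * v + c) (B * v + c); have := ler_normD (B * v) c.
have -> : A * u + B * v + c - (B * v + c) = A * u by ring.
lra.
Qed.

Lemma norm_const_le A B c u v : `|A| <= D -> `|B| <= D -> `|A * u + B * v + c| <= e ->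
  `|u| <= e -> `|v| <= e -> `|c| <= 3 * D * e.
Proof.
move=> A_D B_D z_e u_e v_e.
have Au : `|A * u| <= D * e by rewrite normrM ler_pM.
have Bv : `|B * v| <= D * e by rewrite normrM ler_pM.
have De : e <= D * e by rewrite ler_peMl.
have := ler_normB (A * u + B * v + c) (A * u + B * v); have := ler_normD (A * u) (B * v).
have -> : A * u + B * v + c - (A * u + B * v) = c by ring.
lra.
Qed.

Variables (H11 H12 H21 H22 w1 w2 w1' w2' x1 x2 y1 y2 : F).
Hypothesis bounds : all (fun z => 1 <= `|z| <= D)
  [:: H11; H12; H21; H22; w1; w2; w1'; w2'].
Hypotheses (x1E : x1 = H11 * y1 + H12 * y2 + w1)
           (x2E : x2 = H21 * y1 + H22 * y2 + w2)
           (y1E : y1 = H22 * x1 - H12 * x2 + w1')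
           (y2E : y2 = - H21 * x1 + H11 * x2 + w2').

(** Here x and y are the coordinates of a point with respect to two affine frames.
    The letter (true, false) expands x1 and contracts x2, so it can fail to
    increase the height only for small x1; its inverse (true, true) needs a
    small x2; the letters (false, _) do the same with y. *)
Definition strip (l : bool * bool) : bool :=
  `|if l.1 then if l.2 then x2 else x1 else if l.2 then y2 else y1| <= e.

(** The four axes have pairwise different directions, quantitatively so because no
    entry of the change of frame is smaller than 1 in absolute value. *)
Lemma two_strips l m : l != m -> strip l -> strip m ->
  Num.max `|x1| `|x2| <= 2 * D * e + D.
Proof.
have e_D : e <= 2 * D * e + D.
  have : e <= D * e by rewrite ler_peMl.
  by move: D1 e0; lra.
move: bounds; rewrite /= andbT.
case/and4P=> /andP[? ?] /andP[? ?] /andP[? ?].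
case/and5P=> /andP[? ?] /andP[? ?] /andP[? ?] /andP[? ?] /andP[? ?].
(* up to exchanging l and m, six pairs remain *)
wlog lm : l m / (m.1 ==> l.1) && ((l.1 == m.1) ==> m.2).
  move=> W; case: l m => [[] []] [[] []] // _ ? ?; solve [exact: (W (true, false) (true, true))
   | exact: (W (false, false) (false, true))
   | exact: (W (true, false) (false, true))
   | exact: (W (true, false) (false, false))
   | exact: (W (true, true) (false, true))
   | exact: (W (true, true) (false, false))].
rewrite ge_max; case: l m lm => [[] []] [[] []] //= _ _; rewrite /strip /= => l_e m_e.
- rewrite (le_trans l_e e_D) andbT.
  by apply: (@norm_solve_le (- H21) H11 w2' x1 x2); rewrite ?normrN -?y2E.
- rewrite (le_trans l_e e_D) andbT.
  apply: (@norm_solve_le H22 (- H12) w1' x1 x2); rewrite ?normrN //.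
  by move: m_e; rewrite y1E mulNr.
- by rewrite (le_trans l_e e_D) (le_trans m_e e_D).
- rewrite (le_trans l_e e_D).
  by apply: (@norm_solve_le H11 (- H21) w2' x2 x1); rewrite ?normrN // [H11 * x2 + _]addrC -y2E.
- rewrite (le_trans l_e e_D).
  apply: (@norm_solve_le (- H12) H22 w1' x2 x1); rewrite ?normrN //.
  by move: m_e; rewrite y1E mulNr [- _ + _]addrC.
- by rewrite x1E x2E !norm_affine_le.
Qed.

(** Three strips contain the two strips of one frame, hence confine the point
    to the vicinity of the origin of this frame, which lies on no axis of the other one. *)
Lemma three_strips l m n : uniq [:: l; m; n] -> 3 * D * e < 1 ->
  ~ [/\ strip l, strip m & strip n].
Proof.
move=> lmn e_small; move: bounds; rewrite /= andbT.
case/and4P=> /andP[? ?] /andP[? ?] /andP[? ?].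
case/and5P=> /andP[? ?] /andP[? ?] /andP[? ?] /andP[? ?] /andP[? ?].
have c_big c : 1 <= `|c| -> `|c| <= 3 * D * e -> False by lra.
have not_x12y i : strip (true, true) -> strip (true, false) -> ~ strip (false, i).
  rewrite /strip /= => x2_e x1_e; case: i => y_e; [apply: (@c_big w2')|apply: (@c_big w1')] => //.
    by apply: (@norm_const_le (- H21) H11 w2' x1 x2); rewrite ?normrN -?y2E.
  by apply: (@norm_const_le H22 (- H12) w1' x1 x2); rewrite ?normrN ?mulNr -?y1E.
have not_y12x i : strip (false, true) -> strip (false, false) -> ~ strip (true, i).
  rewrite /strip /= => y2_e y1_e; case: i => x_e; [apply: (@c_big w2)|apply: (@c_big w1)] => //.
    by apply: (@norm_const_le H21 H22 w2 y1 y2); rewrite -?x2E.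
  by apply: (@norm_const_le H11 H12 w1 y1 y2); rewrite -?x1E.
by case: l m n lmn => [[] []] [[] []] [[] []] // _ [] sl sm sn;
  solve [exact: (@not_x12y true) | exact: (@not_x12y false)
        | exact: (@not_y12x true) | exact: (@not_y12x false)].
Qed.

End Strips.

Section Coordinates.
Variables (F : realFieldType) (G : groupType) (X : Type) (act : G -> X -> X).
Hypothesis act1 : forall x, act 1%g x = x.
Hypothesis actM : forall g h x, act (g * h)%g x = act g (act h x).
Implicit Types (g h : G) (x : X).

Definition acts_as (xi1 xi2 : X -> F) g (A11 A12 A21 A22 v1 v2 : F) : Prop :=
  forall x, xi1 (act g x) = A11 * xi1 x + A12 * xi2 x + v1 /\
            xi2 (act g x) = A21 * xi1 x + A22 * xi2 x + v2.

Section Fixed.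
Variables xi1 xi2 : X -> F.
Local Notation acts_as := (acts_as xi1 xi2).

Lemma acts_as_mul g h A11 A12 A21 A22 v1 v2 B11 B12 B21 B22 w1 w2 :
  acts_as g A11 A12 A21 A22 v1 v2 -> acts_as h B11 B12 B21 B22 w1 w2 ->
  acts_as (g * h)%g (A11 * B11 + A12 * B21) (A11 * B12 + A12 * B22)
    (A21 * B11 + A22 * B21) (A21 * B12 + A22 * B22)
    (A11 * w1 + A12 * w2 + v1) (A21 * w1 + A22 * w2 + v2).
Proof.
move=> gE hE x; rewrite actM; have [-> ->] := gE (act h x).
by have [-> ->] := hE x; split; ring.
Qed.

Lemma acts_as_inv g A11 A12 A21 A22 v1 v2 :
  A11 * A22 - A12 * A21 = 1 -> acts_as g A11 A12 A21 A22 v1 v2 ->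
  acts_as g^-1%g A22 (- A12) (- A21) A11 (A12 * v2 - A22 * v1) (A21 * v1 - A11 * v2).
Proof.
move=> det1 gE x; have [] := gE (act g^-1%g x); rewrite -actM mulgV act1 => -> ->.
set y1 := xi1 _; set y2 := xi2 _.
by split; [rewrite -[LHS]mul1r|rewrite -[LHS]mul1r]; rewrite -det1; ring.
Qed.

Lemma acts_as_diagX g c d n : acts_as g c 0 0 d 0 0 ->
  acts_as (g ^+ n)%g (c ^+ n) 0 0 (d ^+ n) 0 0.
Proof.
move=> gE; elim: n => [|n IH].
  by move=> x; rewrite expg0 act1 !expr0; split; ring.
rewrite expgS => x; have [-> ->] := acts_as_mul gE IH x.
by rewrite !exprS; split; ring.
Qed.

End Fixed.

Section TwoHyperbolics.
Variables (xi1 xi2 : X -> F) (a h : G) (L D H11 H12 H21 H22 w1 w2 : F).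
Local Notation acts_as := (acts_as xi1 xi2).
Local Notation b := (h * a * h^-1)%g.
Local Notation phi := (fun x => Num.max `|xi1 x| `|xi2 x|).
Hypotheses (D1 : 1 <= D) (L_D : 18 * D ^+ 3 < L).
Hypothesis aE : acts_as a L 0 0 L^-1 0 0.
Hypothesis hE : acts_as h H11 H12 H21 H22 w1 w2.
Hypothesis det1 : H11 * H22 - H12 * H21 = 1.
Hypothesis bounds : all (fun z => 1 <= `|z| <= D)
  [:: H11; H12; H21; H22; w1; w2; H12 * w2 - H22 * w1; H21 * w1 - H11 * w2].

Let L0 : 0 < L.
Proof. by apply: le_lt_trans L_D; rewrite mulr_ge0 // exprn_ge0 // (le_trans _ D1). Qed.

(* 3 D / L is the relative width of the strips at distance x from the origin *)
Let e x : F := 3 * D / L * Num.max (phi x) (2 * D).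

Let e_ge0 x : 0 <= e x.
Proof.
have D0 : 0 <= D by rewrite (le_trans _ D1).
by rewrite mulr_ge0 ?divr_ge0 ?mulr_ge0 ?(ltW L0) // !le_max normr_ge0.
Qed.

Let aVE : acts_as a^-1%g L^-1 0 0 L 0 0.
Proof.
move=> x; have [] := acts_as_inv _ aE x; first by rewrite mulr0 subr0 divff // gt_eqF.
by move=> -> ->; split; ring.
Qed.

Let diag_strip m z : `|L * z| <= 3 * D * m -> `|z| <= 3 * D / L * m.
Proof.
by rewrite normrM (gtr0_norm L0) => H; rewrite mulrAC ler_pdivlMr // mulrC.
Qed.

(** A letter expanding a coordinate by L keeps the height bounded only where this
    coordinate is L times smaller; for the letters of b the height is first
    transported by h^-1, which costs a factor 3 D. *)
Lemma nonescaping_strip l x : nonescaping act a b phi (2 * D) l x ->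
  strip (e x) (xi1 x) (xi2 x) (xi1 (act h^-1%g x)) (xi2 (act h^-1%g x)) l.
Proof.
rewrite /nonescaping /strip /e; set m := Num.max _ (2 * D).
have m_D : 2 * D <= m by rewrite le_max lexx orbT.
have le3 z : `|z| <= m -> `|z| <= 3 * D * m.
  move=> /le_trans; apply; rewrite ler_peMl //; last by move: D1; lra.
  by move: m_D D1; lra.
have inv_le z1 z2 : `|z1| <= m -> `|z2| <= m ->
    `|H22 * z1 - H12 * z2 + (H12 * w2 - H22 * w1)| <= 3 * D * m /\
    `|- H21 * z1 + H11 * z2 + (H21 * w1 - H11 * w2)| <= 3 * D * m.
  move=> z1_m z2_m; move: bounds; rewrite /= andbT.
  case/and4P=> /andP[? ?] /andP[? ?] /andP[? ?].
  case/and5P=> /andP[? ?] /andP[? ?] /andP[? ?] /andP[? ?] /andP[? ?].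
  have m0 : 0 <= m by move: m_D D1; lra.
  have up : 2 * D * m + D <= 3 * D * m.
    have : D <= D * m by rewrite ler_peMr //; move: m_D D1; lra.
    lra.
  split; apply: le_trans up; last by apply: norm_affine_le; rewrite ?normrN.
  by rewrite -mulNr; apply: norm_affine_le; rewrite ?normrN.
have hVE := acts_as_inv det1 hE.
case: l => [[] []] /=; rewrite /letter_val /= ?invgM ?invgK ?actM.
- rewrite ge_max => /andP[_]; have [_ ->] := aVE x.
  by rewrite mul0r add0r addr0 => /le3/diag_strip.
- rewrite ge_max => /andP[+ _]; have [-> _] := aE x.
  by rewrite mul0r !addr0 => /le3/diag_strip.
- set y := act h^-1%g x; set z := act h _; rewrite ge_max => /andP[z1_m z2_m].
  have [_] := inv_le _ _ z1_m z2_m; have [_ <-] := hVE z.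
  rewrite /z -actM mulVg act1; have [_ ->] := aVE y.
  by rewrite mul0r add0r addr0 => /diag_strip.
set y := act h^-1%g x; set z := act h _; rewrite ge_max => /andP[z1_m z2_m].
have [+ _] := inv_le _ _ z1_m z2_m; have [yE _] := hVE z.
rewrite -mulNr -yE /z -actM mulVg act1; have [-> _] := aE y.
by rewrite mul0r !addr0 => /diag_strip.
Qed.

Let coordsE x : let y := act h^-1%g x in
  [/\ xi1 x = H11 * xi1 y + H12 * xi2 y + w1,
      xi2 x = H21 * xi1 y + H22 * xi2 y + w2,
      xi1 y = H22 * xi1 x - H12 * xi2 x + (H12 * w2 - H22 * w1) &
      xi2 y = - H21 * xi1 x + H11 * xi2 x + (H21 * w1 - H11 * w2)].
Proof.
move=> y; have [y1E y2E] := acts_as_inv det1 hE x.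
have [] := hE y; rewrite -actM mulgV act1 => x1E x2E.
by split=> //; rewrite y1E mulNr.
Qed.

Let nonescaping2 l m x : l != m -> nonescaping act a b phi (2 * D) l x ->
  nonescaping act a b phi (2 * D) m x -> phi x <= 2 * D.
Proof.
move=> lm /nonescaping_strip sl /nonescaping_strip sm; rewrite leNgt; apply/negP => far.
have [x1E x2E y1E y2E] := coordsE x.
have := two_strips D1 (e_ge0 x) bounds x1E x2E y1E y2E lm sl sm.
rewrite /e /=; set p := Num.max `|xi1 x| _ in far *; rewrite (max_l (ltW far)) => near.
have D0 : 0 < D by move: D1; lra.
have eps : 2 * D * (3 * D / L * p) <= p / 2.
  rewrite (_ : _ * _ = 6 * D ^+ 2 / L * p); last by ring.
  rewrite [p / 2]mulrC ler_pM2r; last by move: far D0; lra.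
  rewrite ler_pdivrMr //.
  have : D ^+ 2 <= D ^+ 3 by rewrite [D ^+ 3]exprS ler_peMl // exprn_ge0 // ltW.
  by move: L_D (sqr_ge0 D); lra.
by move: near eps far; lra.
Qed.

Let nonescaping3 l m n x : uniq [:: l; m; n] ->
  ~ [/\ nonescaping act a b phi (2 * D) l x, nonescaping act a b phi (2 * D) m x &
        nonescaping act a b phi (2 * D) n x].
Proof.
move=> lmn [l_x m_x n_x].
have near : phi x <= 2 * D.
  by apply: (@nonescaping2 l m x) => //; move: lmn; rewrite /= inE negb_or => /andP[/andP[]].
have [x1E x2E y1E y2E] := coordsE x.
apply: (three_strips D1 (e_ge0 x) bounds x1E x2E y1E y2E lmn); last first.
  by split; apply: nonescaping_strip.
rewrite /e (max_r near) (_ : _ * _ = 18 * D ^+ 3 / L); last by ring.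
by rewrite ltr_pdivrMr // mul1r.
Qed.

Lemma two_hyperbolics_pingpong x0 : 2 * D < phi x0 ->
  freely_generate a b /\ locally_commutative act (generated [set a; b]).
Proof.
move=> far; split.
  exact: (pingpong_freely_generate act1 actM nonescaping2 far).
exact: (pingpong_locally_commutative act1 actM nonescaping2 nonescaping3).
Qed.

End TwoHyperbolics.

(** * The conjugating element *)

Section Conjugator.
Variable C : F.
Hypothesis C100 : 100 <= C.

Let C0 : 0 < C. Proof. exact: lt_le_trans C100. Qed.
Let C1 : 1 <= C. Proof. by apply: le_trans C100; rewrite ler1n. Qed.
Let Cexp m n : (m <= n)%N -> C ^+ m <= C ^+ n. Proof. exact: ler_weXn2l. Qed.
Let CX n : 1 <= C ^+ n. Proof. exact: exprn_ege1. Qed.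
Let CXC n : C ^+ n * C^-1 ^+ n = 1. Proof. by rewrite -exprMn divff ?expr1n // gt_eqF. Qed.

(** The exponents below: the entries of g lie in [C^-1, C], a coordinate of v is
    usable when it is at least C^-5, and with the power 8 of a0 the dominant term
    is at least C^8 C^-1 C^-5 = C^2, which beats the remainder of size 3 C. *)
Lemma dominant_term (p q : F) : C ^+ 2 <= `|p| <= C ^+ 11 -> `|q| <= 3 * C ->
  1 <= `|p + q| <= C ^+ 12.
Proof.
move=> /andP[p_big p_le] q_le.
have C2 : 100 * C <= C ^+ 2 by rewrite expr2 ler_pM2r.
have C12 : 100 * C ^+ 11 <= C ^+ 12 by rewrite [C ^+ 12]exprS ler_pM2r // exprn_gt0.
have C11 : C <= C ^+ 11 by rewrite -[leLHS]expr1 Cexp.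
apply/andP; split.
  have := ler_normD (p + q) (- q); rewrite addrK normrN; move: C100; lra.
by have := ler_normD p q; move: C100; lra.
Qed.

Lemma large_product (x y : F) : C^-1 <= `|x| <= C -> C^-1 ^+ 5 <= `|y| <= C ^+ 2 ->
  C ^+ 2 <= `|x * C ^+ 8 * y| <= C ^+ 11.
Proof.
move=> /andP[x_ge x_le] /andP[y_ge y_le].
have C8 : 0 < C ^+ 8 by exact: exprn_gt0.
rewrite normrM (normrM x) (gtr0_norm C8).
rewrite (_ : _ * _ * _ = C ^+ 8 * (`|x| * `|y|)); last by ring.
rewrite (_ : C ^+ 2 = C ^+ 8 * (C^-1 * C^-1 ^+ 5)); last first.
  by rewrite -exprS -[8%N]/(2 + 6)%N exprD -mulrA CXC mulr1.
rewrite (_ : C ^+ 11 = C ^+ 8 * (C * C ^+ 2)); last by rewrite -exprS -exprD.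
by rewrite !ler_pM2l ?exprn_gt0 // !ler_pM // ?exprn_ge0 ?invr_ge0 ?(ltW C0).
Qed.

Lemma small_product (x y : F) : `|x| <= C -> `|y| <= C ^+ 2 -> `|x * C^-1 ^+ 8 * y| <= 1.
Proof.
move=> x_le y_le; have c0 n : 0 <= C^-1 ^+ n by rewrite exprn_ge0 // invr_ge0 ltW.
rewrite normrM (normrM x) (ger0_norm (c0 _)).
rewrite -[leRHS](CXC 8) mulrAC ler_wpM2r //.
apply: le_trans (_ : C * C ^+ 2 <= _); first by rewrite ler_pM.
by rewrite -exprS Cexp.
Qed.

Variables (xi1 xi2 : X -> F) (a0 g : G) (al be ga de v1 v2 : F).
Hypothesis unbounded : forall B, exists x, B < Num.max `|xi1 x| `|xi2 x|.
Hypothesis a0E : acts_as xi1 xi2 a0 C 0 0 C^-1 0 0.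
Hypothesis gE : acts_as xi1 xi2 g al be ga de v1 v2.
Hypothesis det1 : al * de - be * ga = 1.
Hypotheses (al_C : C^-1 <= `|al| <= C) (be_C : C^-1 <= `|be| <= C)
           (ga_C : C^-1 <= `|ga| <= C) (de_C : C^-1 <= `|de| <= C).
Hypotheses (v1_1 : `|v1| <= 1) (v2_1 : `|v2| <= 1).

(** The large eigenvalue dominates the entries of h, of h(0) = g a0^8 v + v and
    of h^-1(0) = - (y + g^-1 a0^-8 y) with y = g^-1 v (linear parts understood), as
    soon as v1 and y2, which a0^8 and a0^-8 expand, are not too small. *)
Lemma conjugator_pingpong :
  C^-1 ^+ 5 <= `|v1| -> C^-1 ^+ 5 <= `|al * v2 - ga * v1| ->
  let h := (g * a0 ^+ 8 * g)%g in let a := (a0 ^+ 37)%g in let b := (h * a * h^-1)%g in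
  freely_generate a b /\ locally_commutative act (generated [set a; b]).
Proof.
set y2 := al * v2 - _ => v1_ge y2_ge h a b.
set y1 := de * v1 - be * v2.
set K := C ^+ 8; set k := C^-1 ^+ 8.
have Kk : K * k = 1 by exact: CXC.
have gEdiag : acts_as xi1 xi2 (a0 ^+ 8)%g K 0 0 k 0 0 by apply: acts_as_diagX.
have aE : acts_as xi1 xi2 a (C ^+ 37) 0 0 (C ^+ 37)^-1 0 0.
  by rewrite -exprVn; apply: acts_as_diagX.
have hE := acts_as_mul (acts_as_mul gE gEdiag) gE; rewrite -/h in hE.
have [x0 far] := unbounded (2 * C ^+ 12).
have D1 : 1 <= C ^+ 12 by exact: CX.
(* 37 makes C^37 larger than 18 D^3 for D = C^12 *)
apply: (two_hyperbolics_pingpong D1 _ aE hE _ _ far).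
- rewrite -exprM [C ^+ 37]exprS ltr_pM2r ?exprn_gt0 //; move: C100; lra.
- transitivity ((al * de - be * ga) ^+ 2 * (K * k)); first by ring.
  by rewrite det1 Kk expr1n mulr1.
have upC (x : F) : C^-1 <= `|x| <= C -> `|x| <= C by case/andP.
have upC2 (x : F) : `|x| <= C -> `|x| <= C ^+ 2.
  by move=> /le_trans; apply; rewrite -[leLHS]expr1 Cexp.
have up1 (x : F) : `|x| <= 1 -> `|x| <= C ^+ 2 by move=> /le_trans; apply.
have wide (x : F) : C^-1 <= `|x| <= C -> C^-1 ^+ 5 <= `|x| <= C ^+ 2.
  case/andP=> x_ge /upC2 ->; rewrite andbT; apply: le_trans x_ge.
  have c0 : 0 <= C^-1 by rewrite invr_ge0 ltW.
  by rewrite exprS ler_piMr // exprn_ile1 // invf_le1.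
have wide_v1 : C^-1 ^+ 5 <= `|v1| <= C ^+ 2 by rewrite v1_ge up1.
have y_le (A B : F) : `|A| <= C -> `|B| <= C -> `|A * v1 - B * v2| <= 2 * C.
  move=> A_C B_C; have := ler_normB (A * v1) (B * v2); rewrite !normrM.
  have : `|A| * `|v1| <= C * 1 by rewrite ler_pM.
  have : `|B| * `|v2| <= C * 1 by rewrite ler_pM.
  lra.
have C2 : 100 * C <= C ^+ 2 by rewrite expr2 ler_pM2r.
have y1_le : `|y1| <= 2 * C by apply: y_le; apply: upC.
have y2_le : `|y2| <= 2 * C by rewrite distrC; apply: y_le; apply: upC.
have y1_C2 : `|y1| <= C ^+ 2 by move: y1_le C2 C0; lra.
have y2_C2 : `|y2| <= C ^+ 2 by move: y2_le C2 C0; lra.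
have wide_y2 : C^-1 ^+ 5 <= `|y2| <= C ^+ 2 by rewrite y2_ge y2_C2.
have le1 (q : F) : `|q| <= 1 -> `|q| <= 3 * C by move: C100; lra.
have leD (q q' : F) : `|q| <= 1 -> `|q'| <= 2 * C -> `|q + q'| <= 3 * C.
  by have := ler_normD q q'; move: C100; lra.
have le2 (q : F) : `|q| <= 1 -> `|q| <= 2 * C by move: C100; lra.
have dom (p q z : F) : z = p + q -> C ^+ 2 <= `|p| <= C ^+ 11 -> `|q| <= 3 * C -> 1 <= `|z| <= C ^+ 12.
  by move=> ->; exact: dominant_term.
have [al0 be0 ga0 de0] := And4 (upC _ al_C) (upC _ be_C) (upC _ ga_C) (upC _ de_C).
have dK1 : (al * de - be * ga) * (K * k) = 1 by rewrite det1 Kk mulr1.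
apply/allP => z; rewrite !inE.
case/or4P => [/eqP->|/eqP->|/eqP->|/or4P[/eqP->|/eqP->|/eqP->|/orP[]/eqP->]].
- apply: (dom (al * K * al) (be * k * ga)); first by ring.
    by apply: large_product => //; exact: wide.
  by apply/le1/small_product => //; exact: upC2.
- apply: (dom (al * K * be) (be * k * de)); first by ring.
    by apply: large_product => //; exact: wide.
  by apply/le1/small_product => //; exact: upC2.
- apply: (dom (ga * K * al) (de * k * ga)); first by ring.
    by apply: large_product => //; exact: wide.
  by apply/le1/small_product => //; exact: upC2.
- apply: (dom (ga * K * be) (de * k * de)); first by ring.
    by apply: large_product => //; exact: wide.
  by apply/le1/small_product => //; exact: upC2.
- apply: (dom (al * K * v1) (be * k * v2 + v1)); first by ring.
    exact: large_product.
  by apply: leD; [apply: small_product => //; exact: up1|exact: le2].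
- apply: (dom (ga * K * v1) (de * k * v2 + v2)); first by ring.
    exact: large_product.
  by apply: leD; [apply: small_product => //; exact: up1|exact: le2].
- apply: (dom (be * K * y2) (- (de * k * y1) - (al * de - be * ga) * (K * k) * y1)).
  + by rewrite /y1 /y2; ring.
  + exact: large_product.
  by rewrite dK1 mul1r; apply: leD; rewrite normrN //; exact: small_product.
apply: (dom (- (al * K * y2)) (ga * k * y1 - (al * de - be * ga) * (K * k) * y2)).
- by rewrite /y1 /y2; ring.
- by rewrite normrN; exact: large_product.
by rewrite dK1 mul1r; apply: leD; rewrite ?normrN //; exact: small_product.
Qed.

End Conjugator.

Lemma acts_as_swap xi1 xi2 g A11 A12 A21 A22 v1 v2 :
  acts_as xi1 xi2 g A11 A12 A21 A22 v1 v2 ->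
  acts_as xi2 xi1 g A22 A21 A12 A11 v2 v1.
Proof. by move=> gE x; have [-> ->] := gE x; split; ring. Qed.

(** If neither sign of the exponent is usable, then v and y = g^-1 v are both close
    to the same axis, or one of them is close to 0.  But v has norm 1, and g, having
    no small entry, moves each axis away from itself. *)
Lemma hyperbolic_pingpong C xi1 xi2 a0 g al be ga de v1 v2 : 100 <= C ->
  (forall B, exists x, B < Num.max `|xi1 x| `|xi2 x|) ->
  acts_as xi1 xi2 a0 C 0 0 C^-1 0 0 -> acts_as xi1 xi2 g al be ga de v1 v2 ->
  al * de - be * ga = 1 ->
  C^-1 <= `|al| <= C -> C^-1 <= `|be| <= C -> C^-1 <= `|ga| <= C -> C^-1 <= `|de| <= C ->
  Num.max `|v1| `|v2| = 1 ->
  exists2 a1, a1 = a0 \/ a1 = a0^-1%g &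
  let h := (g * a1 ^+ 8 * g)%g in let a := (a1 ^+ 37)%g in let b := (h * a * h^-1)%g in
  freely_generate a b /\ locally_commutative act (generated [set a; b]).
Proof.
move=> C100 far a0E gE det1 al_C be_C ga_C de_C v_1.
have C0 : 0 < C by exact: lt_le_trans C100.
have v1_1 : `|v1| <= 1 by rewrite -v_1 le_max lexx.
have v2_1 : `|v2| <= 1 by rewrite -v_1 le_max lexx orbT.
set t : F := C^-1 ^+ 5; set y1 := de * v1 - be * v2; set y2 := al * v2 - ga * v1.
have t0 : 0 < t by rewrite exprn_gt0 // invr_gt0.
have t3 : 100 * (C ^+ 3 * t) <= 1.
  have -> : C ^+ 3 * t = C^-1 ^+ 2.
    by rewrite /t (exprD _ 3 2) mulrA -exprMn divff ?gt_eqF // expr1n mul1r.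
  by rewrite exprVn ler_pdivrMr ?exprn_gt0 // mul1r expr2; move: C100; nra.
have t2 : 100 * (C ^+ 2 * t) <= C ^+ 3 * t.
  by rewrite mulrA ler_pM2r // [C ^+ 3]exprS ler_pM2r ?exprn_gt0.
have t1 : 100 * (C * t) <= C ^+ 2 * t by rewrite mulrA ler_pM2r // expr2 ler_pM2r.
have t_0 : 100 * t <= C * t by rewrite ler_pM2r.
have up (A B c d : F) : C^-1 <= `|A| <= C -> C^-1 <= `|B| <= C ->
    `|A * c + B * d| <= C * `|c| + C * `|d|.
  move=> /andP[_ A_C] /andP[_ B_C].
  by apply: le_trans (ler_normD _ _) _; rewrite !normrM lerD // ler_wpM2r.
have solve_le (A B c d z : F) : C^-1 <= `|A| <= C -> C^-1 <= `|B| <= C ->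
    z = A * c + B * d -> `|z| < t -> `|d| < t -> `|c| <= C * t + C ^+ 2 * t.
  move=> /andP[A_C _] /andP[_ B_C] zE z_t d_t.
  have Ac : `|A * c| <= t + C * t.
    have -> : A * c = z - B * d by rewrite zE; ring.
    by apply: le_trans (ler_normB _ _) _; rewrite normrM lerD ?(ltW z_t) // ler_pM // ltW.
  have : C * (C^-1 * `|c|) <= C * (t + C * t).
    by rewrite ler_pM2l //; apply: le_trans Ac; rewrite normrM ler_wpM2r.
  by rewrite mulrA divff ?gt_eqF // mul1r mulrDr mulrA -expr2.
have v1E : v1 = al * y1 + be * y2 by rewrite -[LHS]mul1r -det1 /y1 /y2; ring.
have v2E : v2 = ga * y1 + de * y2 by rewrite -[LHS]mul1r -det1 /y1 /y2; ring.
have small_le (z : F) : `|z| < t -> `|z| <= C * t + C ^+ 2 * t by move: t_0 t1 t0; lra.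
have y_small : `|y1| <= C * t + C ^+ 2 * t -> `|y2| <= C * t + C ^+ 2 * t -> False.
  move=> y1_le y2_le.
  have Cy c : c <= C * t + C ^+ 2 * t -> C * c <= C ^+ 2 * t + C ^+ 3 * t.
    have -> : C ^+ 2 * t + C ^+ 3 * t = C * (C * t + C ^+ 2 * t) by ring.
    by rewrite ler_pM2l.
  have : Num.max `|v1| `|v2| < 1.
    rewrite gt_max v1E v2E (le_lt_trans (up _ _ _ _ al_C be_C)) ?(le_lt_trans (up _ _ _ _ ga_C de_C)) //.
      by move: (Cy _ y1_le) (Cy _ y2_le) t0 t_0 t1 t2 t3; lra.
    by move: (Cy _ y1_le) (Cy _ y2_le) t0 t_0 t1 t2 t3; lra.
  by rewrite v_1 ltxx.
have v12 : `|v1| < t -> `|v2| < t -> False.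
  move=> v1_t v2_t; suff : Num.max `|v1| `|v2| < 1 by rewrite v_1 ltxx.
  by rewrite gt_max; move: v1_t v2_t t0 t_0 t1 t2 t3; lra.
have y12 : `|y1| < t -> `|y2| < t -> False by move=> /small_le ? /small_le; exact: y_small.
have vy1 : `|v1| < t -> `|y1| < t -> False.
  move=> v1_t y1_t; apply: (y_small (small_le _ y1_t)).
  by apply: (solve_le be al y2 y1 v1) => //; rewrite addrC.
have vy2 : `|v2| < t -> `|y2| < t -> False.
  move=> v2_t y2_t; apply: (fun y1_le => y_small y1_le (small_le _ y2_t)).
  exact: (solve_le ga de y1 y2 v2).
have [/andP[v1_t y2_t]|small] := boolP ((t <= `|v1|) && (t <= `|y2|)).
  by exists a0; [left|apply: (conjugator_pingpong C100 far a0E gE det1)].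
have [v2_t y1_t] : t <= `|v2| /\ t <= `|y1|.
  by move: small; rewrite negb_and -!ltNge => /orP[] small; split;
    rewrite leNgt; apply/negP => ?; auto.
(* the symmetric choice, with the two coordinates exchanged *)
have a0VE : acts_as xi2 xi1 a0^-1%g C 0 0 C^-1 0 0.
  apply: acts_as_swap => x; have [|-> ->] := acts_as_inv _ a0E x.
    by rewrite mulr0 subr0 divff ?gt_eqF.
  by split; ring.
exists a0^-1%g; first by right.
apply: (conjugator_pingpong C100 _ a0VE (acts_as_swap gE)) => //; last by rewrite -det1; ring.
by move=> B; have [x] := far B; exists x; rewrite maxC.
Qed.

End Coordinates.

Section Balancing.
Variables (F : rcfType) (G : groupType) (X : Type) (act : G -> X -> X).
Hypothesis act1 : forall x, act 1%g x = x.
Hypothesis actM : forall g h x, act (g * h)%g x = act g (act h x).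
Local Notation acts_as := (acts_as act).

Lemma acts_as_scale k1 k2 xi1 xi2 g (A11 A12 A21 A22 v1 v2 : F) :
  k1 != 0 -> k2 != 0 -> acts_as xi1 xi2 g A11 A12 A21 A22 v1 v2 ->
  acts_as (fun x => k1 * xi1 x) (fun x => k2 * xi2 x) g
    A11 (k1 / k2 * A12) (k2 / k1 * A21) A22 (k1 * v1) (k2 * v2).
Proof. by move=> k10 k20 gE x; have [-> ->] := gE x; split; field. Qed.

(** Only the product be * ga is controlled.  Multiplying the coordinates by
    multiples of Num.sqrt `|ga| and Num.sqrt `|be| makes both entries equal to
    its square root in absolute value, without changing al and de; a common
    factor remains free to normalize the translation part. *)
Lemma balanced_pingpong (L T : F) xi1 xi2 a g al be ga de v1 v2 :
  3 <= T -> T <= L ^+ 2 ->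
  (forall B, exists x, B < Num.max `|xi1 x| `|xi2 x|) ->
  acts_as xi1 xi2 a L 0 0 L^-1 0 0 -> acts_as xi1 xi2 g al be ga de v1 v2 ->
  al * de - be * ga = 1 ->
  `|al| <= T ^+ 5 -> `|de| <= T ^+ 5 ->
  1 <= T ^+ 2 * `|al * de| -> 1 <= T ^+ 2 * `|be * ga| -> (v1, v2) != (0, 0) ->
  exists2 a1, a1 = (a ^+ 16)%g \/ a1 = (a ^+ 16)^-1%g &
  let h := (g * a1 ^+ 8 * g)%g in let a := (a1 ^+ 37)%g in let b := (h * a * h^-1)%g in
  freely_generate a b /\ locally_commutative act (generated [set a; b]).
Proof.
move=> T3 T_L far aE gE det1 al_T de_T alde_T bega_T v_neq0.
have T1 : 1 <= T by move: T3; lra.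
have T0 : 0 < T by move: T3; lra.
have T8 : T ^+ 8 <= L ^+ 16.
  by rewrite -[16%N]/(2 * 8)%N exprM lerXn2r // ?nnegrE ?(ltW T0) // sqr_ge0.
have C100 : 100 <= L ^+ 16.
  apply: le_trans T8; have -> : T ^+ 8 = (T ^+ 2) ^+ 4 by rewrite -exprM.
  have T9 : 9 <= T ^+ 2 by rewrite expr2; move: T3; nra.
  apply: le_trans (_ : 9 ^+ 4 <= _); first by rewrite -natrX ler_nat.
  by rewrite lerXn2r // nnegrE ?sqr_ge0.
have C0 : 0 < L ^+ 16 by exact: lt_le_trans C100.
have Texp m n : (m <= n)%N -> T ^+ m <= T ^+ n by exact: ler_weXn2l.
have in_range (z : F) : 1 <= T ^+ 8 * `|z| -> `|z| <= T ^+ 8 -> (L ^+ 16)^-1 <= `|z| <= L ^+ 16.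
  move=> z_ge z_le; rewrite (le_trans z_le T8) andbT -[_^-1]mul1r ler_pdivrMr //.
  by rewrite mulrC; apply: le_trans z_ge _; rewrite ler_wpM2r.
have side (z z' : F) : 1 <= T ^+ 2 * `|z * z'| -> `|z'| <= T ^+ 5 -> `|z| <= T ^+ 5 ->
    (L ^+ 16)^-1 <= `|z| <= L ^+ 16.
  move=> zz_ge z'_le z_le; apply: in_range; last exact: le_trans z_le (Texp _ _ _).
  apply: le_trans zz_ge _; rewrite normrM mulrCA mulrC ler_wpM2r //.
  apply: le_trans (_ : T ^+ 2 * T ^+ 5 <= _); first by rewrite ler_pM2l // exprn_gt0.
  by rewrite -exprD Texp.
have al_C := side _ _ alde_T de_T al_T.
have de_C : (L ^+ 16)^-1 <= `|de| <= L ^+ 16 by apply: (side de al); rewrite // [de * al]mulrC.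
have bega_gt0 : 0 < `|be * ga|.
  by rewrite normr_gt0; apply: contraTneq bega_T => ->; rewrite normr0 mulr0 ler10.
have [be0 ga0] : 0 < `|be| /\ 0 < `|ga|.
  by move: bega_gt0; rewrite !normr_gt0 mulf_eq0 negb_or => /andP[].
pose sb := Num.sqrt `|be|; pose sg := Num.sqrt `|ga|.
have sb0 : 0 < sb by rewrite sqrtr_gt0.
have sg0 : 0 < sg by rewrite sqrtr_gt0.
have sbE : sb ^+ 2 = `|be| by rewrite sqr_sqrtr.
have sgE : sg ^+ 2 = `|ga| by rewrite sqr_sqrtr.
have bal_C (z : F) : `|z| = sb * sg -> (L ^+ 16)^-1 <= `|z| <= L ^+ 16.
  move=> zE; have s2 : (sb * sg) ^+ 2 = `|be * ga| by rewrite exprMn sbE sgE normrM.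
  have s0 : 0 < sb * sg by exact: mulr_gt0.
  have Ts : 1 <= T * (sb * sg).
    have Ts0 : 0 <= T * (sb * sg) by rewrite ltW // mulr_gt0.
    rewrite -(@ler_pXn2r _ 2) ?nnegrE // expr1n exprMn s2.
    exact: bega_T.
  apply: in_range; rewrite zE.
    apply: le_trans Ts _; rewrite ler_pM2r //.
    by rewrite -[leLHS]expr1 Texp.
  rewrite -(@ler_pXn2r _ 2) ?nnegrE ?exprn_ge0 ?(ltW T0) ?(ltW s0) // s2.
  have -> : be * ga = al * de - 1 by rewrite -det1; ring.
  apply: le_trans (ler_normB _ _) _; rewrite normrM normr1.
  have : `|al| * `|de| <= T ^+ 5 * T ^+ 5 by rewrite ler_pM.
  rewrite -exprD -exprM /= => H.
  have T10 : 1 <= T ^+ 10 by exact: exprn_ege1.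
  have : 3 * T ^+ 10 <= T ^+ 11 by rewrite [T ^+ 11]exprS ler_pM2r // exprn_gt0.
  have : T ^+ 11 <= T ^+ 16 by exact: Texp.
  by move: H T10; rewrite -[(5 + 5)%N]/10%N; lra.
pose m := Num.max (sg * `|v1|) (sb * `|v2|).
have m0 : 0 < m.
  rewrite lt_max !pmulr_rgt0 // !normr_gt0.
  by move: v_neq0; rewrite xpair_eqE negb_and.
pose k1 := sg / m; pose k2 := sb / m.
have k10 : 0 < k1 by exact: divr_gt0.
have k20 : 0 < k2 by exact: divr_gt0.
have far' B : exists x, B < Num.max `|k1 * xi1 x| `|k2 * xi2 x|.
  have k0 : 0 < Num.min k1 k2 by rewrite lt_min k10.
  have [x far_x] := far (B / Num.min k1 k2); exists x; move: far_x.
  rewrite ltr_pdivrMr // (normrM k1) (normrM k2) (gtr0_norm k10) (gtr0_norm k20) => /lt_le_trans; apply.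
  have [_|_] := leP `|xi1 x| `|xi2 x|; rewrite mulrC le_max !ler_wpM2r ?orbT //.
    by rewrite ge_min lexx orbT.
  by rewrite ge_min lexx.
have aE' := acts_as_scale (lt0r_neq0 k10) (lt0r_neq0 k20)
  (acts_as_diagX act1 actM 16 aE).
have gE' := acts_as_scale (lt0r_neq0 k10) (lt0r_neq0 k20) gE.
apply: (hyperbolic_pingpong act1 actM C100 far' _ gE' _ al_C _ _ de_C).
- by move=> x; have [-> ->] := aE' x; rewrite exprVn; split; ring.
- by rewrite -[RHS]det1; field; rewrite !lt0r_neq0.
- apply: bal_C; rewrite normrM -sbE gtr0_norm ?divr_gt0 // /k1 /k2.
  by field; rewrite !lt0r_neq0.
- apply: bal_C; rewrite normrM -sgE gtr0_norm ?divr_gt0 // /k1 /k2.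
  by field; rewrite !lt0r_neq0.
rewrite (normrM k1) (normrM k2) (gtr0_norm k10) (gtr0_norm k20) /k1 /k2 !(mulrAC _ m^-1).
rewrite -maxr_pMl ?invr_ge0 ?(ltW m0) //; exact: divff (lt0r_neq0 m0).
Qed.

End Balancing.

(** * Traces of integer matrices of size 2 *)

Section Mx2.
Variable R : comNzRingType.
Implicit Types A B M : 'M[R]_2.

Lemma mx2P A B : A 0 0 = B 0 0 -> A 0 1 = B 0 1 -> A 1 0 = B 1 0 -> A 1 1 = B 1 1 ->
  A = B.
Proof.
have ord2 (i : 'I_2) : i = 0 \/ i = 1 by case: i => [[|[|//]] ?]; [left|right]; exact: val_inj.
by move=> *; apply/matrixP => i j; case: (ord2 i) (ord2 j) => -> [] ->.
Qed.

Lemma sum_ord2 (V : nmodType) (f : 'I_2 -> V) : \sum_i f i = f 0 + f 1.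
Proof. by rewrite !big_ord_recl big_ord0 addr0; congr (_ + f _); apply: val_inj. Qed.

Lemma mulmx2E A B i j : (A *m B) i j = A i 0 * B 0 j + A i 1 * B 1 j.
Proof. by rewrite mxE sum_ord2. Qed.

Lemma mulmx_col2E A (v : 'cV[R]_2) i : (A *m v) i 0 = A i 0 * v 0 0 + A i 1 * v 1 0.
Proof. by rewrite mxE sum_ord2. Qed.

Lemma mxtrace2 A : \tr A = A 0 0 + A 1 1. Proof. exact: sum_ord2. Qed.

Lemma det2 A : \det A = A 0 0 * A 1 1 - A 0 1 * A 1 0.
Proof.
rewrite (expand_det_row _ 0) sum_ord2 /cofactor !det_mx11 !mxE /=.
have -> : lift 0 0 = 1 :> 'I_2 by exact: val_inj.
have -> : lift 1 0 = 0 :> 'I_2 by exact: val_inj.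
by rewrite /= expr0 expr1 /bump /=; ring.
Qed.

(** Cayley-Hamilton, as a formula for the inverse. *)
Lemma mulmx2_adj A : A *m ((\tr A)%:M - A) = (\det A)%:M.
Proof. by apply: mx2P; rewrite mulmx2E det2 mxtrace2 !mxE /= ?mulr1n ?mulr0n; ring. Qed.

End Mx2.

Section Discriminant.
Variable R : comNzRingType.
Implicit Types A G : 'M[R]_2.

(** The discriminant of the characteristic polynomial is a quadratic form of
    signature (2, 1) on traceless matrices, and polar is its bilinear form. *)
Definition disc A := \tr A ^+ 2 - 4 * \det A.
Definition polar A G := 2 * \tr (A *m G) - \tr A * \tr G.

(** One of the minors of the traceless parts of A and G; matrices of size 2
    commute exactly when all these minors vanish. *)
Definition cross A G := A 1 0 * (G 0 0 - G 1 1) - G 1 0 * (A 0 0 - A 1 1).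

Let E := (mxtrace2, det2, mulmx2E).

Lemma disc_det1 A : \det A = 1 -> disc A = \tr A ^+ 2 - 4.
Proof. by rewrite /disc => ->; rewrite mulr1. Qed.

(** When disc A is negative, or not a square, this shows that the Gram determinant
    on the left vanishes only if the traceless parts of A and G are
    proportional. *)
Lemma polar_gram A G : A 1 0 ^+ 2 * (polar A G ^+ 2 - disc A * disc G) =
  (disc A * G 1 0 - A 1 0 * polar A G) ^+ 2 - disc A * cross A G ^+ 2.
Proof. by rewrite /disc /polar /cross !E; ring. Qed.

(** The left-hand side is the discriminant of A 1 0 *: G - G 1 0 *: A, a triangular
    matrix whose diagonal entries differ by cross A G. *)
Lemma polar_cross A G :
  A 1 0 ^+ 2 * disc G - 2 * A 1 0 * G 1 0 * polar A G + G 1 0 ^+ 2 * disc A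
    = cross A G ^+ 2.
Proof. by rewrite /disc /polar /cross !E; ring. Qed.

Lemma trace_commutator A G :
  4 * \tr (A *m G *m ((\tr A)%:M - A) *m ((\tr G)%:M - G)) - 8 * \det A * \det G
    = polar A G ^+ 2 - disc A * disc G.
Proof.
rewrite /disc /polar [X in 4 * X]mxtrace2 !mulmx2E !E !mxE /= ?mulr1n ?mulr0n.
by ring.
Qed.

(** The identities of Fricke and Vogt: the traces of the two cyclic orders of three
    matrices have their sum and product determined by shorter traces. *)
Lemma trace_cycle_sum A B G :
  \tr (A *m B *m G) + \tr (A *m G *m B) =
  \tr A * \tr (B *m G) + \tr B * \tr (A *m G) + \tr G * \tr (A *m B)
    - \tr A * \tr B * \tr G.
Proof. by rewrite !E; ring. Qed.

Lemma trace_cycle_prod A B G : \det A = 1 -> \det B = 1 -> \det G = 1 ->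
  \tr (A *m B *m G) * \tr (A *m G *m B) =
  \tr A ^+ 2 + \tr B ^+ 2 + \tr G ^+ 2 + \tr (A *m B) ^+ 2 + \tr (B *m G) ^+ 2
  + \tr (A *m G) ^+ 2 - \tr A * \tr B * \tr (A *m B) - \tr B * \tr G * \tr (B *m G)
  - \tr A * \tr G * \tr (A *m G) + \tr (A *m B) * \tr (B *m G) * \tr (A *m G) - 4.
Proof.
move=> dA dB dG.
transitivity (\tr A ^+ 2 * (\det B * \det G) + \tr B ^+ 2 * (\det A * \det G)
  + \tr G ^+ 2 * (\det A * \det B) + \tr (A *m B) ^+ 2 * \det G
  + \tr (B *m G) ^+ 2 * \det A + \tr (A *m G) ^+ 2 * \det B
  - \tr A * \tr B * \tr (A *m B) * \det G - \tr B * \tr G * \tr (B *m G) * \det A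
  - \tr A * \tr G * \tr (A *m G) * \det B
  + \tr (A *m B) * \tr (B *m G) * \tr (A *m G) - 4 * (\det A * \det B * \det G)).
  by rewrite !E; ring.
by rewrite dA dB dG; ring.
Qed.

Lemma mulmx2_sandwich A G :
  A *m G *m A = \tr (A *m G) *: A - \det A *: ((\tr G)%:M - G).
Proof. by apply: mx2P; rewrite !E !mxE /= ?mulr1n ?mulr0n; ring. Qed.

End Discriminant.

Section IntegerTraces.
Implicit Types A G : 'M[int]_2.

(** There is no square at distance 4 below t^2 once t^2 is at least 9. *)
Lemma nonsquare_disc (t x y : int) : 3 <= `|t| -> x ^+ 2 = (t ^+ 2 - 4) * y ^+ 2 -> y = 0.
Proof.
move=> t3 xy; apply/eqP/negPn/negP => y0.
have /dvdzP[m xm] : (y %| x)%Z.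
  by rewrite -(@dvdz_pexp2r _ _ 2) // xy dvdz_mull.
have : m ^+ 2 = t ^+ 2 - 4.
  apply: (mulIf (_ : y ^+ 2 != 0)); first by rewrite expf_neq0.
  by rewrite -xy xm exprMn.
rewrite -[m ^+ 2]real_normK ?num_real // -[t ^+ 2]real_normK ?num_real //.
move: t3; set u := `|t|; have : 0 <= `|m| by []; set n := `|m|.
move=> n0 u3 nu; have [un|nu'] := leP u n; nia.
Qed.

Lemma commute_of_proportional A G : A 1 0 != 0 -> cross A G = 0 ->
  A 1 0 * G 0 1 = G 1 0 * A 0 1 -> A *m G = G *m A.
Proof.
rewrite /cross => c0 /eqP; rewrite subr_eq0 => /eqP ad_c bc.
have ad_b : A 0 1 * (G 0 0 - G 1 1) = G 0 1 * (A 0 0 - A 1 1).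
  by apply: (mulfI c0); rewrite mulrCA ad_c [RHS]mulrA bc; ring.
by apply: mx2P; rewrite !mulmx2E; move: bc ad_b ad_c;
  move: (A 0 0) (A 0 1) (A 1 0) (A 1 1) (G 0 0) (G 0 1) (G 1 0) (G 1 1) => *; lia.
Qed.

Lemma commute_of_gram A G : A 1 0 != 0 -> cross A G = 0 ->
  disc A * G 1 0 = A 1 0 * polar A G -> A *m G = G *m A.
Proof.
move=> c0 X0 DB; apply: (commute_of_proportional c0 X0).
have id2 : 2 * A 1 0 * (A 1 0 * G 0 1 - G 1 0 * A 0 1) =
    - (A 0 0 - A 1 1) * cross A G - (disc A * G 1 0 - A 1 0 * polar A G).
  by rewrite /disc /polar /cross !(mxtrace2, det2, mulmx2E); ring.
move: id2; rewrite X0 DB mulr0 !subrr => /eqP.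
by rewrite !mulf_eq0 (negPf c0) subr_eq0 => /eqP.
Qed.

(** Two elliptic elements fix distinct points of the hyperbolic plane unless
    they commute, and then their commutator is hyperbolic: this is the reversed
    Cauchy-Schwarz inequality for the discriminant form. *)
Lemma trace_commutator_elliptic A G : \det A = 1 -> \det G = 1 ->
  `|\tr A| <= 1 -> `|\tr G| <= 1 -> A *m G <> G *m A ->
  3 <= \tr (A *m G *m ((\tr A)%:M - A) *m ((\tr G)%:M - G)).
Proof.
move=> dA dG tA tG nc.
have neg (M : 'M[int]_2) : \det M = 1 -> `|\tr M| <= 1 -> disc M < 0.
  by move=> dM tM; rewrite disc_det1 // expr2; move: (\tr M) tM {tA tG dM} => t; nia.
have c0 : A 1 0 != 0.
  apply/eqP => c0; move: (neg A dA tA); rewrite /disc mxtrace2 det2 c0.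
  rewrite (_ : _ - _ = (A 0 0 - A 1 1) ^+ 2); last by ring.
  by rewrite ltNge sqr_ge0.
have := trace_commutator A G; have := polar_gram A G; rewrite dA dG.
set P := polar A G ^+ 2 - _; move: (\tr (_ *m _)) => t gram tE.
suff P0 : 0 < P by move: P0 tE; clearbody P; lia.
have c2 : 0 < A 1 0 ^+ 2 by rewrite lt0r expf_neq0 ?sqr_ge0.
have D0 := neg A dA tA.
rewrite -(pmulr_rgt0 _ c2) gram -[- (disc A * _)]mulNr lt0r.
have DX0 : 0 <= - disc A * cross A G ^+ 2 by rewrite mulr_ge0 ?sqr_ge0 // oppr_ge0 ltW.
apply/andP; split; last by apply: addr_ge0 => //; exact: sqr_ge0.
rewrite paddr_eq0 // ?sqr_ge0 // sqrf_eq0 subr_eq0 mulf_eq0 oppr_eq0 (lt_eqF D0) /= sqrf_eq0; apply/negP => /andP[/eqP u0 /eqP X0].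
exact/nc/commute_of_gram.
Qed.

(** A matrix of trace at most 2 in absolute value that is orthogonal to a
    parabolic U for the discriminant form shares its fixed point on the
    boundary, hence commutes with it. *)
Lemma polar_parabolic U G : \det U = 1 -> \det G = 1 -> `|\tr U| = 2 ->
  `|\tr G| <= 2 -> U *m G <> G *m U -> polar U G != 0.
Proof.
move=> dU dG tU tG nc; apply/eqP => B0; apply: nc.
have D0 : disc U = 0 by rewrite disc_det1 // expr2; move: (\tr U) tU => t; nia.
have D'0 : disc G <= 0 by rewrite disc_det1 // expr2; move: (\tr G) tG => t; nia.
have [c0|c0] := eqVneq (U 1 0) 0; last first.
  apply: commute_of_gram => //; last by rewrite D0 B0 mul0r mulr0.
  have := polar_cross U G; rewrite B0 D0 !mulr0 subr0 addr0 => X2.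
  apply/eqP; rewrite -sqrf_eq0 eq_le sqr_ge0 -X2 andbT.
  by rewrite mulr_ge0_le0 ?sqr_ge0.
have ad : U 0 0 = U 1 1.
  apply/eqP; rewrite -subr_eq0 -sqrf_eq0 -D0 /disc mxtrace2 det2 c0.
  by apply/eqP; ring.
have bc : U 0 1 * G 1 0 = 0.
  have bcE : polar U G = 2 * (U 0 1 * G 1 0).
    by rewrite /polar !(mxtrace2, mulmx2E) c0 ad; ring.
  by apply/eqP; move/eqP: B0; rewrite bcE mulf_eq0.
have [b0|b0] := eqVneq (U 0 1) 0.
  by apply: mx2P; rewrite !mulmx2E ?c0 ?b0 ?ad; ring.
have c'0 : G 1 0 = 0 by apply/eqP; move/eqP: bc; rewrite mulf_eq0 (negPf b0).
have ad' : G 0 0 = G 1 1.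
  have D'E : disc G = (G 0 0 - G 1 1) ^+ 2.
    by rewrite /disc mxtrace2 det2 c'0; ring.
  by apply/eqP; rewrite -subr_eq0 -sqrf_eq0 eq_le sqr_ge0 andbT -D'E.
by apply: mx2P; rewrite !mulmx2E ?c0 ?c'0 ?ad ?ad'; ring.
Qed.

(** With eps = 1 or -1 the eigenvalue of U, the trace of U^5 G is
    eps \tr G + 5 m, where m is half of polar U G and does not vanish. *)
Lemma trace_pow5_parabolic U G : \det U = 1 -> \det G = 1 -> `|\tr U| = 2 ->
  `|\tr G| <= 2 -> U *m G <> G *m U ->
  3 <= `|\tr (U *m U *m U *m U *m U *m G)|.
Proof.
move=> dU dG tU tG nc; have := polar_parabolic dU dG tU tG nc.
have CH : U *m U = \tr U *: U - 1%:M.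
  by rewrite -dU -(mulmx2_adj U) mulmxBr mul_mx_scalar subKr.
have -> : \tr (U *m U *m U *m U *m U *m G) =
    (\tr U ^+ 4 - 3 * \tr U ^+ 2 + 1) * \tr (U *m G)
      - (\tr U ^+ 3 - 2 * \tr U) * \tr G.
  have -> : U *m U *m U *m U *m U = (\tr U ^+ 4 - 3 * \tr U ^+ 2 + 1) *: U
      - (\tr U ^+ 3 - 2 * \tr U)%:M.
    have step x y : (x *: U - y%:M) *m U = (x * \tr U - y) *: U - x%:M.
      rewrite mulmxBl -scalemxAl CH mul_scalar_mx scalerBr scalerA scalerBl.
      by rewrite scale_scalar_mx mulr1 addrAC.
    by rewrite CH !step; congr (_ *: _ - _%:M); ring.
  by rewrite mulmxBl raddfB /= -scalemxAl mxtraceZ mul_scalar_mx mxtraceZ.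
rewrite /polar; move: (\tr U) (\tr G) (\tr (U *m G)) tU tG => t s r t2 s2.
have -> : (t ^+ 4 - 3 * t ^+ 2 + 1) * r - (t ^+ 3 - 2 * t) * s = 5 * r - 2 * (t * s).
  have : t ^+ 2 = 4 by rewrite -[t ^+ 2]real_normK ?num_real // t2.
  by rewrite (exprD t 2 2) (exprS t 2) => ->; ring.
have [->|->] : t = 2 \/ t = - 2 by lia.
  by lia.
by lia.
Qed.

Lemma hyperbolic_lower_neq0 A : \det A = 1 -> 3 <= `|\tr A| -> A 1 0 != 0.
Proof.
move=> dA tA; apply/eqP => c0; have : (1 : int) = 0 => //.
apply: (nonsquare_disc tA (x := A 0 0 - A 1 1)).
by rewrite expr1n mulr1 -disc_det1 // /disc mxtrace2 det2 c0; ring.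
Qed.

(** The discriminant form is degenerate on the span of the traceless parts of A
    and G only if A and G share an eigenvector.  Those of A are irrational, so that an integer
    matrix sharing one of them also shares its conjugate. *)
Lemma gram_hyperbolic A G : \det A = 1 -> 3 <= `|\tr A| ->
  A *m G <> G *m A -> polar A G ^+ 2 - disc A * disc G != 0.
Proof.
move=> dA tA nc; apply/eqP => gram0; apply: nc.
have := polar_gram A G; rewrite gram0 mulr0 => /esym/eqP; rewrite subr_eq0 => /eqP gramE.
have X0 : cross A G = 0 by apply: (nonsquare_disc tA); rewrite -disc_det1 //; exact: gramE.
apply: (commute_of_gram (hyperbolic_lower_neq0 dA tA)) => //; apply/eqP; rewrite -subr_eq0 -sqrf_eq0 gramE X0.
by rewrite expr0n mulr0.
Qed.

(** If the expression vanishes then G and A G have trace zero, so that both have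
    square -1, and G inverts A. *)
Lemma antipolar_hyperbolic A G : \det A = 1 -> \det G = 1 -> 3 <= `|\tr A| ->
  A *m G *m A <> G ->
  \tr (A *m G) * \tr G * \tr A - \tr (A *m G) ^+ 2 - \tr G ^+ 2 != 0.
Proof.
move=> dA dG tA nc; apply/eqP => n0; apply: nc.
have s0 : \tr G = 0.
  apply: (nonsquare_disc tA (x := 2 * \tr (A *m G) - \tr G * \tr A)).
  apply/eqP; rewrite -subr_eq0 (_ : _ - _ = - 4 * (\tr (A *m G) * \tr G * \tr A
    - \tr (A *m G) ^+ 2 - \tr G ^+ 2)); last by ring.
  by rewrite n0 mulr0.
have r0 : \tr (A *m G) = 0.
  apply/eqP; rewrite -sqrf_eq0 -oppr_eq0 -n0 s0; apply/eqP; ring.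
by rewrite mulmx2_sandwich dA s0 r0 scale0r scale1r raddf0 !sub0r opprK.
Qed.

(** The two traces are the roots of a monic quadratic polynomial whose
    coefficients only involve the traces of shorter products. *)
Lemma trace_triple_le (A B G : 'M[int]_2) (T : int) :
  \det A = 1 -> \det B = 1 -> \det G = 1 -> 3 <= T ->
  `|\tr A| <= T -> `|\tr B| <= T -> `|\tr G| <= T ->
  `|\tr (A *m B)| <= T -> `|\tr (B *m G)| <= T -> `|\tr (A *m G)| <= T ->
  `|\tr (A *m B *m G)| <= T ^+ 5.
Proof.
move=> dA dB dG T3.
have := trace_cycle_sum A B G; have := trace_cycle_prod dA dB dG.
move: (\tr (A *m B *m G)) (\tr (A *m G *m B)) => p q.
move: (\tr A) (\tr B) (\tr G) (\tr (A *m B)) (\tr (B *m G)) (\tr (A *m G)).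
move=> x y z xy yz xz prodE sumE x_T y_T z_T xy_T yz_T xz_T.
have T0 : 0 <= T by move: T3; lia.
have le2 (u v : int) : `|u| <= T -> `|v| <= T -> `|u * v| <= T ^+ 2.
  by move=> ? ?; rewrite normrM expr2 ler_pM.
have le3 (u v w : int) : `|u| <= T -> `|v| <= T -> `|w| <= T -> `|u * v * w| <= T ^+ 3.
  by move=> ? ? ?; rewrite normrM exprSr ler_pM ?le2.
have T2 : 3 * T ^+ 2 <= T ^+ 3 by rewrite [T ^+ 3]exprS ler_wpM2r ?exprn_ge0.
have T9 : 9 <= T ^+ 2 by rewrite expr2 -[9]/(3 * 3 : int) ler_pM.
have T5 : 9 * T ^+ 3 <= T ^+ 5 by rewrite (exprD T 2 3) ler_wpM2r ?exprn_ge0.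
have sum_le : `|p + q| <= 2 * T ^+ 3.
  rewrite sumE; move: (le2 _ _ x_T yz_T) (le2 _ _ y_T xz_T) (le2 _ _ z_T xy_T)
    (le3 _ _ _ x_T y_T z_T) T2.
  move: (x * yz) (y * xz) (z * xy) (x * y * z) (T ^+ 2) (T ^+ 3).
  by clear; lia.
have prod_le : `|p * q| <= 7 * T ^+ 3.
  rewrite prodE; move: (le2 _ _ x_T x_T) (le2 _ _ y_T y_T) (le2 _ _ z_T z_T)
    (le2 _ _ xy_T xy_T) (le2 _ _ yz_T yz_T) (le2 _ _ xz_T xz_T)
    (le3 _ _ _ x_T y_T xy_T) (le3 _ _ _ y_T z_T yz_T) (le3 _ _ _ x_T z_T xz_T)
    (le3 _ _ _ xy_T yz_T xz_T) T2 T9; rewrite -!expr2.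
  move: (x ^+ 2) (y ^+ 2) (z ^+ 2) (xy ^+ 2) (yz ^+ 2) (xz ^+ 2) (x * y * xy)
    (y * z * yz) (x * z * xz) (xy * yz * xz) (T ^+ 2) (T ^+ 3).
  by clear; lia.
apply: le_trans T5; rewrite leNgt; apply/negP => p_big.
have : `|p| * `|p| <= `|p| * (2 * T ^+ 3) + 7 * T ^+ 3.
  rewrite -normrM (_ : p * p = p * (p + q) - p * q); last by ring.
  apply: le_trans (ler_normB _ _) _; rewrite (normrM p (p + q)) lerD //.
  by rewrite ler_wpM2l.
move: p_big T2 T9; move: `|p| (T ^+ 2) (T ^+ 3).
by clear; nia.
Qed.

End IntegerTraces.

(** * Generated subgroups, solvability and powers of a set *)

Section GroupSets.
Variable G : groupType.
Implicit Types (S H K : set G) (x y g : G).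

Lemma generated_subgroup S : is_subgroup (generated S).
Proof.
split=> [K [[K1 _ _] _] //|x y xS yS K KS|x xS K KS].
  by have [[_ KM _] _] := KS; apply: KM; [exact: xS|exact: yS].
by have [[_ _ KV] _] := KS; apply: KV; exact: xS.
Qed.

Lemma generated_min S K : is_subgroup K -> S `<=` K -> generated S `<=` K.
Proof. by move=> Ksub SK x gen_x; apply: (gen_x K). Qed.

Lemma derived_min H K : is_subgroup K ->
  (forall x y, H x -> H y -> K [~ x, y]%g) -> derived H `<=` K.
Proof.
by move=> Ksub HK; apply: generated_min => // _ [x [y [Hx Hy ->]]]; exact: HK.
Qed.

Lemma solvable_of_iter_derived_sub1 H n : iter n.+1 (@derived G) H `<=` [set 1%g] ->
  solvable_subgroup H.
Proof.
move=> Hn; exists n.+1; apply/seteqP; split=> // _ ->.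
by have [] := generated_subgroup
  [set g | exists x y, [/\ iter n (@derived G) H x, iter n (@derived G) H y & g = [~ x, y]%g]].
Qed.

Lemma virtually_solvable_of_solvable H : is_subgroup H -> solvable_subgroup H ->
  virtually_solvable H.
Proof.
move=> Hsub Hsol; exists H; split=> //.
apply: (@sub_finite_set _ _ [set H]); last exact: finite_set1.
move=> _ [x Hx <-] /=; have [_ HM HV] := Hsub; apply/seteqP; split.
  by move=> _ [h Hh <-]; exact: HM.
by move=> y Hy; exists (x^-1 * y)%g; [apply: HM => //; exact: HV|rewrite mulVKg].
Qed.

Lemma setpowS S n g : setpow S n.+1 g <-> exists x y, [/\ S x, setpow S n y & g = (x * y)%g].
Proof.
split=> [[s [Ss ->]]|[x [_ [Sx [s [Ss ->]] ->]]]].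
  rewrite big_ord_recl; exists (s ord0), (\prod_(i < n) s (lift ord0 i))%g; split=> //.
  by exists (fun i => s (lift ord0 i)).
exists (fun i => if unlift ord0 i is Some j then s j else x); split.
  by move=> i; case: unliftP.
by rewrite big_ord_recl unlift_none; congr (_ * _)%g; apply: eq_bigr => i _; rewrite liftK.
Qed.

Lemma setpow0 S g : setpow S 0 g <-> g = 1%g.
Proof.
split=> [[s [_ ->]]|->]; first by rewrite big_ord0.
by exists (fun=> 1%g); split; [case|rewrite big_ord0].
Qed.

Lemma setpow1 S g : setpow S 1 g <-> S g.
Proof.
rewrite setpowS; split=> [[x [y [Sx /setpow0 -> ->]]]|Sg]; first by rewrite mulg1.
by exists g, 1%g; split=> //; [exact/setpow0|rewrite mulg1].
Qed.

Lemma setpowD S m n g :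
  setpow S (m + n) g <-> exists x y, [/\ setpow S m x, setpow S n y & g = (x * y)%g].
Proof.
elim: m g => [|m IH] g.
  split=> [Sg|[x [y [/setpow0 -> Sy ->]]]]; last by rewrite mul1g.
  by exists 1%g, g; split=> //; [exact/setpow0|rewrite mul1g].
rewrite addSn setpowS; split.
  move=> [x [_ [Sx /IH[y [z [Sy Sz ->]]] ->]]]; exists (x * y)%g, z.
  by split=> //; [apply/setpowS; exists x, y|rewrite mulgA].
move=> [_ [z [/setpowS[x [y [Sx Sy ->]]] Sz ->]]]; exists x, (y * z)%g.
by split=> //; [apply/IH; exists y, z|rewrite mulgA].
Qed.

Lemma setpowM S m n g h : setpow S m g -> setpow S n h -> setpow S (m + n) (g * h)%g.
Proof. by move=> Sg Sh; apply/setpowD; exists g, h. Qed.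

Lemma setpowSr S n g h : setpow S n g -> S h -> setpow S n.+1 (g * h)%g.
Proof. by move=> Sg Sh; rewrite -addn1; apply: setpowM => //; exact/setpow1. Qed.

Lemma setpowX S m n g : setpow S m g -> setpow S (n * m) (g ^+ n)%g.
Proof.
move=> Sg; elim: n => [|n IH]; first by rewrite expg0; apply/setpow0.
by rewrite expgS mulSn; exact: setpowM.
Qed.

Lemma setpowV S n g : symmetric_set S -> setpow S n g -> setpow S n g^-1%g.
Proof.
move=> Ssym; elim: n g => [|n IH] g; first by move=> /setpow0 ->; rewrite invg1; apply/setpow0.
move=> /setpowS[x [y [Sx Sy ->]]]; rewrite invgM -addn1; apply: setpowM; first exact: IH.
by apply/setpow1; rewrite -Ssym; exists x.
Qed.

Lemma setpow_le S m n g : S 1%g -> (m <= n)%N -> setpow S m g -> setpow S n g.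
Proof.
move=> S1 /subnKC <- Sg; rewrite -[g]mulg1; apply: setpowM => //.
rewrite -[X in setpow _ X _]muln1 -[1%g in X in setpow _ _ X](expg1n _ (n - m)).
by apply/setpowX/setpow1.
Qed.

Lemma setpow_finite S n : finite_set S -> finite_set (setpow S n).
Proof.
move=> fS; elim: n => [|n IH].
  by apply: (@sub_finite_set _ _ [set 1%g]) => [g /setpow0 //|]; exact: finite_set1.
apply: (@sub_finite_set _ _ [set (x * y)%g | x in S & y in setpow S n]).
  by move=> g /setpowS[x [y [Sx Sy ->]]]; exists x => //; exists y.
exact: finite_image2.
Qed.

End GroupSets.

Section ThetaMorphism.
Implicit Types (g h : SA2Z) (S : set SA2Z).

Lemma thetaM g h : theta (g * h)%g = theta g *m theta h. Proof. by []. Qed.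
Lemma theta1 : theta 1%g = 1%:M. Proof. by []. Qed.
Lemma tauM g h : tau (g * h)%g = theta g *m tau h + tau g. Proof. by []. Qed.

Lemma thetaV g : theta g^-1%g = (\tr (theta g))%:M - theta g.
Proof.
rewrite -[RHS]mul1mx -theta1 -(mulVg g) thetaM -mulmxA mulmx2_adj det_theta.
by rewrite mulmx1.
Qed.

Lemma translations_subgroup : is_subgroup [set g | theta g = 1%:M].
Proof.
split=> [//|g h /= g1 h1|g /= g1]; first by rewrite thetaM g1 h1 mulmx1.
by rewrite -[LHS]mulmx1 -[X in _ *m X]g1 -thetaM mulVg.
Qed.

Lemma subgroup1 : is_subgroup [set 1%g : SA2Z].
Proof. by split=> [//|_ _ -> ->|_ ->]; rewrite ?mulg1 ?invg1. Qed.

Lemma translations_commute g h : theta g = 1%:M -> theta h = 1%:M -> [~ g, h]%g = 1%g.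
Proof.
move=> g1 h1; apply/eqP/commgP/SA2Z_eq; first by rewrite !thetaM g1 h1.
by rewrite !tauM g1 h1 !mul1mx addrC.
Qed.

Lemma commute_theta_commutator g h : theta g *m theta h = theta h *m theta g ->
  theta [~ g, h]%g = 1%:M.
Proof.
move=> gh; have -> : [~ g, h]%g = ((h * g)^-1 * (g * h))%g.
  by rewrite invgM commgEl conjgE !mulgA.
by rewrite thetaM (thetaM g h) gh -(thetaM h g) -thetaM mulVg.
Qed.

End ThetaMorphism.

(** * Subgroups without hyperbolic or transverse elements *)

Section Degenerate.
Implicit Types (a g h x y : SA2Z) (S : set SA2Z).

Lemma virtually_solvable_of_commuting S :
  (forall x y, S x -> S y -> theta x *m theta y = theta y *m theta x) ->
  virtually_solvable (generated S).
Proof.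
move=> S_comm.
have centralizer g : is_subgroup [set h | theta g *m theta h = theta h *m theta g].
  split=> [|x y /= gx gy|x /= gx]; first by rewrite /= theta1 mulmx1 mul1mx.
    by rewrite thetaM mulmxA gx -mulmxA gy mulmxA.
  by rewrite thetaV mulmxBr mulmxBl scalar_mxC gx.
have gen_comm x y : generated S x -> generated S y ->
    theta x *m theta y = theta y *m theta x.
  move=> gx; apply: (generated_min (centralizer x)) => z Sz /=; apply/esym; move: x gx.
  by apply: (generated_min (centralizer z)) => x Sx; exact: S_comm.
apply: virtually_solvable_of_solvable; first exact: generated_subgroup.
apply: (@solvable_of_iter_derived_sub1 _ _ 1); apply: derived_min subgroup1 _.
have abel : derived (generated S) `<=` [set g | theta g = 1%:M].
  apply: (derived_min translations_subgroup) => x y gx gy.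
  exact/commute_theta_commutator/gen_comm.
by move=> x y /abel x1 /abel y1; exact: translations_commute.
Qed.

Lemma centralizer_abelian (A G H : 'M[int]_2) : A 1 0 != 0 ->
  A *m G = G *m A -> A *m H = H *m A -> G *m H = H *m G.
Proof.
move=> c0 AG AH.
have lin : A 1 0 *: G = G 1 0 *: A + (A 1 0 * G 0 0 - G 1 0 * A 0 0)%:M.
  have entry i j : (A *m G) i j = (G *m A) i j by rewrite AG.
  have := entry 1 0; have := entry 0 0; rewrite !mulmx2E => e00 e10.
  apply: mx2P; rewrite !mxE /= ?mulr1n ?mulr0n; move: e10 e00;
    move: (A 0 0) (A 0 1) (A 1 0) (A 1 1) (G 0 0) (G 0 1) (G 1 0) (G 1 1) => *; lia.
have : A 1 0 *: (G *m H) = A 1 0 *: (H *m G).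
  by rewrite scalemxAl scalemxAr lin mulmxDl mulmxDr -scalemxAl -scalemxAr AH scalar_mxC.
by move=> /matrixP e; apply/matrixP => i j; have := e i j; rewrite !mxE => /(mulfI c0).
Qed.

(** The twisted centralizers G A = A G (for s = false) and A G A = G, that is
    G A = A^-1 G (for s = true); together they form the stabilizer of the axis
    of A when A is hyperbolic. *)
Definition twist (A : 'M[int]_2) (s : bool) g : Prop :=
  if s then A *m theta g *m A = theta g else A *m theta g = theta g *m A.

Lemma twistM A s s' g h : twist A s g -> twist A s' h -> twist A (s (+) s') (g * h)%g.
Proof.
rewrite /twist thetaM; move: (theta g) (theta h) => G H.
case: s s' => [] [] /= Gt Ht.
- by rewrite -[in RHS]Gt -!mulmxA [A *m (H *m A)]mulmxA Ht.
- by rewrite -!mulmxA -Ht [A *m (G *m _)]mulmxA [_ *m (A *m H)]mulmxA Gt.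
- by rewrite mulmxA Gt -!mulmxA [A *m (H *m A)]mulmxA Ht.
by rewrite mulmxA Gt -!mulmxA Ht.
Qed.

Lemma twistV A s g : twist A s g -> twist A s g^-1%g.
Proof.
rewrite /twist; have gV : theta g *m theta g^-1%g = 1%:M by rewrite -thetaM mulgV.
have Vg : theta g^-1%g *m theta g = 1%:M by rewrite -thetaM mulVg.
move: (theta g) (theta g^-1%g) gV Vg => G V gV Vg; case: s => Gt.
  have AV : A *m (G *m A *m V) = 1%:M by rewrite !mulmxA Gt gV.
  have E : V *m (G *m A *m V *m A) = V by rewrite (mulmx1C AV) mulmx1.
  by rewrite -[RHS]E !mulmxA Vg mul1mx.
by rewrite -[LHS]mul1mx -Vg -!mulmxA [G *m _]mulmxA -Gt -!mulmxA gV mulmx1.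
Qed.

(** The sign s is a morphism, the centralizer of A is commutative modulo
    translations, and translations commute: the derived length is at most 3. *)
Lemma virtually_solvable_of_twist (A : 'M[int]_2) S : A 1 0 != 0 ->
  (forall x, S x -> exists s, twist A s x) -> virtually_solvable (generated S).
Proof.
move=> c0 S_tw.
have tw1 : twist A false 1%g by rewrite /twist theta1 mulmx1 mul1mx.
have tw_sub : is_subgroup [set g | exists s, twist A s g].
  split=> [|x y [s ?] [s' ?]|x [s ?]]; first by exists false.
    by exists (s (+) s'); exact: twistM.
  by exists s; exact: twistV.
have cent_sub : is_subgroup [set g | twist A false g].
  split=> [//|x y xA yA|x xA]; first exact: (@twistM A false false x y xA yA).
  exact: (@twistV A false x xA).
apply: virtually_solvable_of_solvable; first exact: generated_subgroup.
apply: (@solvable_of_iter_derived_sub1 _ _ 2) => /=.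
have d1 : derived (generated S) `<=` [set g | twist A false g].
  apply: (derived_min cent_sub) => x y /(generated_min tw_sub S_tw)[s xs].
  move=> /(generated_min tw_sub S_tw)[s' ys].
  have : twist A (s (+) (s' (+) (s (+) s'))) (x^-1 * (y^-1 * (x * y)))%g.
    apply: twistM; first exact: twistV.
    by apply: twistM; [exact: twistV|exact: twistM].
  have -> : s (+) (s' (+) (s (+) s')) = false by case: s s' {xs ys} => [] [].
  by rewrite -conjgE -commgEl.
have d2 : derived (derived (generated S)) `<=` [set g | theta g = 1%:M].
  apply: (derived_min translations_subgroup) => x y /d1 xA /d1 yA.
  exact/commute_theta_commutator/(centralizer_abelian c0).
apply: derived_min subgroup1 _ => x y /d2 x1 /d2 y1.
exact: translations_commute.
Qed.

(** Two noncommuting linear parts with traces at most 2 are either both elliptic,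
    and then their commutator is hyperbolic, or one of them, U, is parabolic and
    U^5 G is hyperbolic.  If all the linear parts commute, the group is solvable. *)
Lemma exists_hyperbolic S : symmetric_set S -> S 1%g ->
  ~ virtually_solvable (generated S) ->
  exists2 a, setpow S 6 a & 3 <= `|\tr (theta a)|.
Proof.
move=> Ssym S1 nvs; apply: contrapT => no_hyp; apply: nvs.
have small n g : (n <= 6)%N -> setpow S n g -> `|\tr (theta g)| <= 2.
  move=> n6 Sg; rewrite leNgt; apply/negP => big; apply: no_hyp; exists g.
    exact: setpow_le Sg.
  by move: big; rewrite -(ltrD2r 1 2); move: `|_| => z; lia.
have S_1 g : S g -> setpow S 1 g by move=> ?; exact/setpow1.
have SV g : S g -> S g^-1%g by move=> Sg; rewrite -Ssym; exists g.
apply: virtually_solvable_of_commuting => x y Sx Sy; apply: contrapT => nc.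
have tr2 g : S g -> `|\tr (theta g)| <= 2 by move=> /S_1; exact: small.
have parabolic g h : S g -> S h -> theta g *m theta h <> theta h *m theta g ->
    `|\tr (theta g)| <> 2.
  move=> Sg Sh gh tg.
  have := trace_pow5_parabolic (det_theta g) (det_theta h) tg (tr2 _ Sh) gh.
  rewrite -!thetaM leNgt => /negP; apply; apply: le_lt_trans (_ : 2 < 3) => //.
  by apply: (small 6) => //; do 5!apply: setpowSr => //; exact: S_1.
have elliptic g h : S g -> S h -> theta g *m theta h <> theta h *m theta g ->
    `|\tr (theta g)| <= 1.
  by move=> Sg Sh gh; have := parabolic _ _ Sg Sh gh; have := tr2 _ Sg; lia.
have := trace_commutator_elliptic (det_theta x) (det_theta y)
  (elliptic _ _ Sx Sy nc) (elliptic _ _ Sy Sx (fun e => nc (esym e))) nc.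
rewrite -!thetaV -!thetaM => t3.
have : `|\tr (theta (x * y * x^-1 * y^-1)%g)| <= 2.
  apply: (small 4) => //.
  by do 3!(apply: setpowSr; last by auto); exact: S_1.
by move: t3; move: (\tr _) => t; lia.
Qed.

End Degenerate.

(** * Eigencoordinates of a hyperbolic element *)

Section EigenCoordinates.
Variable R : rcfType.

Lemma hyperbolic_eigenvalue (t : R) : 3 <= `|t| ->
  exists L : R, [/\ L != 0, L + L^-1 = t & 1 <= `|L|].
Proof.
move=> t3; have t9 : 9 <= t ^+ 2.
  by rewrite -[t ^+ 2]real_normK ?num_real // expr2; nra.
pose q := Num.sqrt (t ^+ 2 - 4).
have qE : q ^+ 2 = t ^+ 2 - 4 by rewrite sqr_sqrtr //; move: t9; lra.
pose L1 := (t + q) / 2; pose L2 := (t - q) / 2.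
have L12 : L1 * L2 = 1.
  transitivity ((t ^+ 2 - q ^+ 2) / 4); first by rewrite /L1 /L2; field.
  by rewrite qE; field.
have [L10 L20] : L1 != 0 /\ L2 != 0.
  by apply/andP; rewrite -negb_or -mulf_eq0 L12 oner_neq0.
have L1V : L1^-1 = L2 by rewrite -[LHS]mulr1 -L12 mulKf.
have sumE : L1 + L2 = t by rewrite /L1 /L2; field.
have [L1_1|L1_1] := leP 1 `|L1|; first by exists L1; rewrite L1V.
exists L2; split=> //; first by rewrite -L1V invrK addrC L1V.
by rewrite -L1V normfV invf_ge1 ?normr_gt0 // ltW.
Qed.

Lemma trace_map_int (A : 'M[int]_2) : \tr (map_mx intr A) = (\tr A)%:~R :> R.
Proof. by rewrite trace_map_mx. Qed.

(** The coordinates are the two eigenforms of theta a, centred at p.  Conjugation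
    keeps the traces of theta g and theta a *m theta g, which determine the
    diagonal entries of g. *)
Lemma eigen_coordinates (a : SA2Z) (p : 'cV[R]_2) (L : R) :
  theta a 1 0 != 0 -> affine_act a p = p ->
  L != 0 -> L + L^-1 = (\tr (theta a))%:~R -> L != L^-1 ->
  exists xi1 xi2 : 'cV[R]_2 -> R,
  [/\ forall x, xi1 x = 0 -> xi2 x = 0 -> x = p,
      forall B, exists x, B < Num.max `|xi1 x| `|xi2 x|,
      acts_as (@affine_act R) xi1 xi2 a L 0 0 L^-1 0 0 &
      forall g, exists al be ga de,
        [/\ acts_as (@affine_act R) xi1 xi2 g al be ga de
              (xi1 (affine_act g p)) (xi2 (affine_act g p)),
            al * de - be * ga = 1,
            al + de = (\tr (theta g))%:~R &
            L * al + L^-1 * de = (\tr (theta a *m theta g))%:~R]].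
Proof.
move=> c0 ap L0 Lt LL.
pose M (g : SA2Z) : 'M[R]_2 := map_mx intr (theta g).
pose P : 'M[R]_2 := \matrix_(i, j)
  if j == 0 then M a 1 0 else (if i == 0 then L else L^-1) - M a 0 0.
pose Lam : 'M[R]_2 := \matrix_(i, j) ((if i == 0 then L else L^-1) *+ (i == j)).
have tE : M a 0 0 + M a 1 1 = L + L^-1 by rewrite Lt -trace_map_int mxtrace2.
have dE : M a 0 0 * M a 1 1 - M a 0 1 * M a 1 0 = 1.
  by rewrite -det2 /M det_map_mx det_theta.
have PA : P *m M a = Lam *m P.
  have LV : L * L^-1 = 1 by exact: divff.
  have d11 : M a 1 1 = L + L^-1 - M a 0 0 by rewrite -tE; ring.
  have bc : M a 0 1 * M a 1 0 = M a 0 0 * (L + L^-1 - M a 0 0) - 1.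
    by rewrite -d11 -dE; ring.
  apply: mx2P; rewrite !mulmx2E ![P _ _]mxE ![Lam _ _]mxE /= ?mulr1n ?mulr0n ?d11.
  - by ring.
  - transitivity (M a 0 1 * M a 1 0 + (L - M a 0 0) * (L + L^-1 - M a 0 0)); first by ring.
    by rewrite bc; transitivity (L ^+ 2 - L * M a 0 0 + (L * L^-1 - 1)); [ring|rewrite LV; ring].
  - by ring.
  transitivity (M a 0 1 * M a 1 0 + (L^-1 - M a 0 0) * (L + L^-1 - M a 0 0)); first by ring.
  by rewrite bc; transitivity (L^-1 ^+ 2 - L^-1 * M a 0 0 + (L * L^-1 - 1)); [ring|rewrite LV; ring].
have Punit : P \in unitmx.
  rewrite unitmxE unitfE det2 !mxE /=.
  rewrite (_ : _ - _ = (theta a 1 0)%:~R * (L^-1 - L)); last by ring.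
  by rewrite mulf_neq0 ?intr_eq0 // subr_eq0 eq_sym.
pose Q := invmx P.
have QP : Q *m P = 1%:M by exact: mulVmx.
have PQ : P *m Q = 1%:M by exact: mulmxV.
pose N g := P *m M g *m Q.
have NE g : N g *m P = P *m M g by rewrite /N -mulmxA QP mulmx1.
have Na : N a = Lam by rewrite /N PA -mulmxA PQ mulmx1.
pose xi x := P *m (x - p).
have xiE g x : xi (affine_act g x) = N g *m xi x + xi (affine_act g p).
  rewrite /xi mulmxA NE -mulmxA -mulmxDr /affine_act -/(M g); congr (P *m _).
  by rewrite mulmxBr [RHS]addrA addrA subrK.
have xia x : xi (affine_act a x) = Lam *m xi x.
  by rewrite xiE ap Na /xi subrr mulmx0 addr0.
exists (fun x => xi x 0 0), (fun x => xi x 1 0); split.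
- move=> x x1 x2; apply/eqP; rewrite -subr_eq0 -[x - p]mul1mx -QP -mulmxA -/(xi x).
  suff -> : xi x = 0 by rewrite mulmx0.
  apply/matrixP => i j; rewrite ord1 [RHS]mxE.
  by case: i => [[|[|//]] i_lt]; [rewrite -[RHS]x1|rewrite -[RHS]x2]; congr (xi x _ _); exact: val_inj.
- move=> B; exists (p + Q *m const_mx (`|B| + 1)).
  rewrite /xi addrC addKr mulmxA PQ mul1mx !mxE maxxx.
  rewrite ger0_norm ?addr_ge0 //; have := ler_norm B; lra.
- move=> x; rewrite xia !mulmx_col2E ![Lam _ _]mxE /= ?mulr1n ?mulr0n.
  by split; ring.
move=> g; exists (N g 0 0), (N g 0 1), (N g 1 0), (N g 1 1).
have detN : \det (N g) = 1.
  rewrite /N !det_mulmx mulrAC -det_mulmx PQ det1 mul1r det_map_mx det_theta.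
  by [].
have trN : \tr (N g) = (\tr (theta g))%:~R.
  by rewrite /N mxtrace_mulC mulmxA QP mul1mx trace_map_int.
have trLN : \tr (Lam *m N g) = (\tr (theta a *m theta g))%:~R.
  rewrite -Na /N -!mulmxA [Q *m _]mulmxA QP mul1mx mxtrace_mulC -!mulmxA QP mulmx1.
  by rewrite -map_mxM trace_map_int.
split.
- by move=> x; rewrite xiE; split; rewrite mxE mulmx_col2E.
- by rewrite -det2.
- by rewrite -mxtrace2.
rewrite -trLN mxtrace2 !mulmx2E ![Lam _ _]mxE /= ?mulr1n ?mulr0n.
by ring.
Qed.

End EigenCoordinates.

(** Solving for the diagonal entries expresses al de and be ga as integers divided
    by t^2 - 4 = (L - L^-1)^2. *)
Section EntryBounds.
Variables (R : rcfType) (L al be ga de : R) (t s r : int).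
Hypotheses (L0 : L != 0) (L1 : 1 <= `|L|) (Lt : L + L^-1 = t%:~R) (t3 : 3 <= `|t|).
Local Notation T := (`|t|%:~R : R).

Let T3 : 3 <= T. Proof. by rewrite (ler_int R 3). Qed.
Let LV1 : `|L^-1| <= 1. Proof. by rewrite normfV invf_le1 // normr_gt0. Qed.
Let LV : L * L^-1 = 1. Proof. exact: divff. Qed.
Let TE : `|L + L^-1| = T. Proof. by rewrite Lt intr_norm. Qed.

Lemma trace_le_sqr_eigenvalue : T <= L ^+ 2.
Proof.
have LT : T - 1 <= `|L| by move: (ler_normD L L^-1) LV1; rewrite TE; lra.
by rewrite -[L ^+ 2]real_normK ?num_real // expr2; move: LT T3; nra.
Qed.

Let LLsqr : (L - L^-1) ^+ 2 = T ^+ 2 - 4.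
Proof.
rewrite -TE real_normK ?num_real //.
transitivity ((L + L^-1) ^+ 2 - 4 * (L * L^-1)); first by ring.
by rewrite LV mulr1.
Qed.

Lemma eigenvalue_gap : 2 <= `|L - L^-1|.
Proof.
have : 5 <= (L - L^-1) ^+ 2 by rewrite LLsqr expr2; move: T3; nra.
by rewrite -[_ ^+ 2]real_normK ?num_real // expr2; move: (normr_ge0 (L - L^-1)); nra.
Qed.

Hypotheses (trg : al + de = s%:~R) (trag : L * al + L^-1 * de = r%:~R).
Hypothesis det1 : al * de - be * ga = 1.
Hypotheses (s_t : `|s| <= `|t|) (r_t : `|r| <= `|t| ^+ 5).

Let alE : al * (L - L^-1) = r%:~R - L^-1 * s%:~R.
Proof. by rewrite -trg -trag; ring. Qed.

Let deE : de * (L - L^-1) = L * s%:~R - r%:~R.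
Proof. by rewrite -trg -trag; ring. Qed.

Lemma diagonal_entries_le : `|al| <= T ^+ 5 /\ `|de| <= T ^+ 5.
Proof.
have sT : `|s%:~R| <= T by rewrite -intr_norm ler_int.
have rT : `|r%:~R| <= T ^+ 5 by rewrite -intr_norm -rmorphXn ler_int.
have LT : `|L| <= T.
  have : `|L| <= `|L + L^-1|.
    have [Lpos|Lneg] := leP 0 L.
      by rewrite !ger0_norm ?addr_ge0 ?invr_ge0 // lerDl invr_ge0.
    have V0 : L^-1 <= 0 by rewrite invr_le0 ltW.
    have S0 : L + L^-1 <= 0 by move: V0 Lneg; lra.
    by rewrite (ltr0_norm Lneg) (ler0_norm S0); move: V0; lra.
  by rewrite TE.
have T2 : T * T <= T ^+ 5 by rewrite -expr2; apply: ler_weXn2l => //; move: T3; lra.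
have T1 : T <= T ^+ 5 by rewrite -[leLHS]expr1; apply: ler_weXn2l => //; move: T3; lra.
have half x : `|x * (L - L^-1)| <= 2 * T ^+ 5 -> `|x| <= T ^+ 5.
  rewrite normrM => H; have : `|x| * 2 <= `|x| * `|L - L^-1|.
    by rewrite ler_wpM2l // eigenvalue_gap.
  by move: H; lra.
split; apply: half; rewrite ?alE ?deE; apply: le_trans (ler_normB _ _) _; rewrite normrM.
  have : `|L^-1| * `|s%:~R| <= 1 * T by rewrite ler_pM.
  by move: rT T1; lra.
have : `|L| * `|s%:~R| <= T * T by rewrite ler_pM.
by move: rT T2; lra.
Qed.

Let int_ge1 (x : R) (n : int) : n != 0 -> x * (T ^+ 2 - 4) = n%:~R -> 1 <= T ^+ 2 * `|x|.
Proof.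
move=> n0 xE; have : 1 <= `|x * (T ^+ 2 - 4)|.
  by rewrite xE -intr_norm (ler_int R 1) -gtz0_ge1 normr_gt0.
have T9 : 9 <= T ^+ 2 by rewrite expr2; move: T3; nra.
rewrite normrM [`|_ - 4|]ger0_norm; last by move: T9; lra.
by move: (normr_ge0 x); nra.
Qed.

Lemma diagonal_entries_ge : r * s * t - r ^+ 2 - s ^+ 2 != 0 ->
  1 <= T ^+ 2 * `|al * de|.
Proof.
move=> n0; apply: (int_ge1 n0); rewrite -LLsqr.
transitivity ((al * (L - L^-1)) * (de * (L - L^-1))); first by ring.
rewrite alE deE !rmorphB !rmorphXn !rmorphM /= -Lt.
transitivity ((r%:~R * s%:~R * (L + L^-1) - r%:~R ^+ 2 - s%:~R ^+ 2 * (L * L^-1)) : R).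
  by ring.
by rewrite LV mulr1.
Qed.

Lemma antidiagonal_entries_ge :
  (2 * r - t * s) ^+ 2 - (t ^+ 2 - 4) * (s ^+ 2 - 4) != 0 ->
  1 <= T ^+ 2 * `|be * ga|.
Proof.
move=> g0; have n0 : r * s * t - r ^+ 2 - s ^+ 2 - (t ^+ 2 - 4) != 0.
  apply: contraNneq g0 => n0; rewrite (_ : _ - _ = - 4 *
    (r * s * t - r ^+ 2 - s ^+ 2 - (t ^+ 2 - 4))); last by ring.
  by rewrite n0 mulr0.
apply: (int_ge1 n0); rewrite -LLsqr.
transitivity ((al * (L - L^-1)) * (de * (L - L^-1)) - (al * de - be * ga) * (L - L^-1) ^+ 2).
  by ring.
rewrite det1 mul1r alE deE !rmorphB !rmorphXn !rmorphM /= -Lt.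
transitivity ((r%:~R * s%:~R * (L + L^-1) - r%:~R ^+ 2 - s%:~R ^+ 2 * (L * L^-1)
  - ((L + L^-1) ^+ 2 - 4 * (L * L^-1))) : R).
  by ring.
by rewrite LV !mulr1.
Qed.

End EntryBounds.

(** * Choice of the two generators *)

Lemma finite_set_argmax (T : choiceType) (f : T -> int) (A : set T) (x0 : T) :
  finite_set A -> A x0 -> exists2 x, A x & forall y, A y -> f y <= f x.
Proof.
move=> /finite_seqP[s ->]; elim: s x0 => // x s IH x0 /=.
case: s IH => [|y s] IH x0_s.
  by exists x; rewrite /= ?mem_head // => z; rewrite inE => /eqP ->.
have [z /= z_s z_max] := IH y (mem_head y s).
have [xz|zx] := leP (f x) (f z).
  exists z; first by rewrite /= inE z_s orbT.
  by move=> w; rewrite /= inE => /predU1P[->//|]; exact: z_max.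
exists x; first exact: mem_head.
move=> w; rewrite /= inE => /predU1P[->//|] w_s.
exact: le_trans (z_max w w_s) (ltW zx).
Qed.

Section FixedPoints.

Lemma hyperbolic_fixed_point (a : SA2Z) : 3 <= `|\tr (theta a)| ->
  exists p : 'cV[rat]_2, affine_act a p = p.
Proof.
move=> ta; pose M : 'M[rat]_2 := map_mx intr (theta a).
have U : 1%:M - M \in unitmx.
  rewrite unitmxE unitfE.
  have -> : \det (1%:M - M) = (2 - \tr (theta a))%:~R.
    have dM : M 0 0 * M 1 1 - M 0 1 * M 1 0 = 1 by rewrite -det2 det_map_mx det_theta.
    rewrite rmorphB /= -trace_map_mx -/M mxtrace2 det2.
    rewrite ![(1%:M - M) _ _]mxE ![(1%:M : 'M_2) _ _]mxE ![(- M) _ _]mxE /=.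
    transitivity (1 - (M 0 0 + M 1 1) + (M 0 0 * M 1 1 - M 0 1 * M 1 0)).
      by rewrite ?mulr1n ?mulr0n; ring.
    by rewrite dM -[2%:~R]/(1 + 1); ring.
  by rewrite intr_eq0; move: ta; lia.
exists (invmx (1%:M - M) *m map_mx intr (tau a)).
set p := _ *m _; have : (1%:M - M) *m p = map_mx intr (tau a) by exact: mulKVmx.
by rewrite mulmxBl mul1mx /affine_act => <-; rewrite addrC subrK.
Qed.

Lemma affine_act_ratr (R : numFieldType) (g : SA2Z) (p : 'cV[rat]_2) :
  affine_act g (map_mx ratr p) = map_mx ratr (affine_act g p) :> 'cV[R]_2.
Proof.
rewrite /affine_act map_mxD map_mxM; congr (_ *m _ + _).
  by apply/matrixP => i j; rewrite !mxE /= ratr_int.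
by apply/matrixP => i j; rewrite !mxE /= ratr_int.
Qed.

Lemma stabilizer_subgroup (p : 'cV[rat]_2) :
  is_subgroup [set g | affine_act g p = p].
Proof.
split=> [|g h /= gp hp|g /= gp]; first exact: affine_act1.
  by rewrite affine_actM hp.
by rewrite -[in LHS]gp -affine_actM mulVg affine_act1.
Qed.

End FixedPoints.

Section Assembly.
Implicit Types (S : set SA2Z).

(** No single generator need move both the axis and the fixed point of a, but a
    product of two does: one generator moves the axis, another one the point. *)
Lemma exists_transverse S a (p : 'cV[rat]_2) : S 1%g ->
  3 <= `|\tr (theta a)| -> affine_act a p = p ->
  ~ virtually_solvable (generated S) ->
  ~ (exists q : 'cV[rat]_2, global_fixed_point (@affine_act rat) (generated S) q) ->
  exists g, [/\ setpow S 2 g, affine_act g p <> p & forall s, ~ twist (theta a) s g].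
Proof.
move=> S1 ta ap nvs nfix.
have S2 g : S g -> setpow S 2 g.
  by move=> Sg; apply: (@setpow_le _ _ 1) => //; exact/setpow1.
have [g1 Sg1 g1_tw] : exists2 g, S g & forall s, ~ twist (theta a) s g.
  apply: contrapT => H; apply: nvs.
  apply: (virtually_solvable_of_twist (hyperbolic_lower_neq0 (det_theta a) ta)).
  move=> x Sx; apply: contrapT => x_tw; apply: H; exists x => // s xs.
  by apply: x_tw; exists s.
have [g2 Sg2 g2_p] : exists2 g, S g & affine_act g p <> p.
  apply: contrapT => H; apply: nfix; exists p => g.
  apply: (generated_min (stabilizer_subgroup p)) => x Sx /=.
  by apply: contrapT => xp; apply: H; exists x.
have [g1_p|g1_p] := pselect (affine_act g1 p = p); last by exists g1; split=> //; exact: S2.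
have [[s g2_tw]|g2_tw] := pselect (exists s, twist (theta a) s g2); last first.
  by exists g2; split=> // [|s ?]; [exact: S2|apply: g2_tw; exists s].
exists (g1 * g2)%g; split.
- by apply: setpowSr => //; exact/setpow1.
- move=> g12_p; apply: g2_p.
  have [_ _ /(_ g1 g1_p) /= g1V_p] := stabilizer_subgroup p.
  by rewrite -[g2](mulKg g1) affine_actM g12_p.
move=> s' g12_tw; apply: (g1_tw (s' (+) s)).
by rewrite -[g1](mulgK g2); apply: twistM => //; exact: twistV.
Qed.

(** Writing a = x y with x, y products of 3 elements, all the traces of shorter
    products that determine the trace of x y g are bounded by that of a. *)
Lemma exists_maximal_hyperbolic S : finite_set S -> symmetric_set S -> S 1%g ->
  ~ virtually_solvable (generated S) ->
  exists2 a, setpow S 6 a & 3 <= `|\tr (theta a)| /\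
    forall g, setpow S 3 g -> `|\tr (theta g)| <= `|\tr (theta a)| /\
      `|\tr (theta a *m theta g)| <= `|\tr (theta a)| ^+ 5.
Proof.
move=> Sfin Ssym S1 nvs.
have [a0 Sa0 ta0] := exists_hyperbolic Ssym S1 nvs.
have [a Sa a_max] := finite_set_argmax (fun g => `|\tr (theta g)|)
  (setpow_finite 6 Sfin) Sa0.
exists a => //; have ta := le_trans ta0 (a_max _ Sa0); split=> // g Sg.
have S6 h : setpow S 3 h -> `|\tr (theta h)| <= `|\tr (theta a)|.
  by move=> Sh; apply: a_max; exact: setpow_le Sh.
have S33 h k : setpow S 3 h -> setpow S 3 k ->
    `|\tr (theta h *m theta k)| <= `|\tr (theta a)|.
  by move=> Sh Sk; rewrite -thetaM; apply: a_max; exact: (@setpowM _ _ 3 3).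
split; first exact: S6.
have [x [y [Sx Sy axy]]] : exists x y, [/\ setpow S 3 x, setpow S 3 y & a = (x * y)%g].
  exact/(@setpowD _ S 3 3).
rewrite {1}axy thetaM; apply: trace_triple_le; rewrite ?det_theta ?S6 ?S33 //.
Qed.

Lemma setpow_pingpong_pair S a g a1 : symmetric_set S -> S 1%g ->
  setpow S 6 a -> setpow S 3 g -> a1 = (a ^+ 16)%g \/ a1 = (a ^+ 16)^-1%g ->
  let h := (g * a1 ^+ 8 * g)%g in
  let n := (3 + 8 * (16 * 6) + 3)%N in let m := (37 * (16 * 6))%N in
  setpow S (n + m + n) (a1 ^+ 37)%g /\ setpow S (n + m + n) (h * a1 ^+ 37 * h^-1)%g.
Proof.
move=> Ssym S1 Sa Sg a1E h n m.
have Sa1 : setpow S (16 * 6) a1.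
  by case: a1E => ->; [|apply: setpowV => //]; exact: setpowX.
have Sh : setpow S n h by do 2?apply: setpowM => //; exact: setpowX.
have Sa37 : setpow S m (a1 ^+ 37)%g by exact: setpowX.
split; first by apply: setpow_le Sa37 => //; rewrite addnAC leq_addl.
by apply: setpowM; [exact: setpowM|exact: setpowV].
Qed.

End Assembly.

Local Close Scope ring_scope.

Theorem theorem1p1 :
  exists N : nat, forall (R : realType) (S : set SA2Z),
    finite_set S ->
    symmetric_set S ->
    S 1%g ->
    ~ virtually_solvable (generated S) ->
    ~ (exists q : 'cV[rat]_2,
         global_fixed_point (@affine_act rat) (generated S) q) ->
    exists a b : SA2Z,
      [/\ setpow S N a,
          setpow S N b,
          freely_generate a b &
          locally_commutative (@affine_act R) (generated [set a; b])].
Proof.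
eexists=> R S Sfin Ssym S1 nvs nfix.
have [a Sa [ta a_max]] := exists_maximal_hyperbolic Sfin Ssym S1 nvs.
have [p ap] := hyperbolic_fixed_point ta.
have [g [Sg gp g_tw]] := exists_transverse S1 ta ap nvs nfix.
have {}Sg : setpow S 3 g by exact: setpow_le Sg.
have [tg tag] := a_max g Sg.
pose t : R := (\tr (theta a))%:~R%R.
have [|L [L0 Lt L1]] := @hyperbolic_eigenvalue R t.
  by rewrite -intr_norm (ler_int R 3).
have gap := eigenvalue_gap L0 Lt ta.
have LL : L != L^-1%R.
  by apply: contraTneq gap => <-; rewrite subrr normr0 -ltNge ltr0n.
pose pR : 'cV[R]_2 := map_mx ratr p.
have apR : affine_act a pR = pR by rewrite affine_act_ratr ap.
have c0 := hyperbolic_lower_neq0 (det_theta a) ta.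
have [xi1 [xi2 [xi_inj far aE gE]]] := eigen_coordinates c0 apR L0 Lt LL.
have [al [be [ga [de [{}gE det1 trg trag]]]]] := gE g.
have [al_T de_T] := diagonal_entries_le L0 L1 Lt ta trg trag tg tag.
have alde_T := diagonal_entries_ge L0 Lt ta trg trag
  (antipolar_hyperbolic (det_theta a) (det_theta g) ta (g_tw true)).
have bega_T : (1 <= `|\tr (theta a)|%:~R ^+ 2 * `|be * ga|)%R.
  apply: (antidiagonal_entries_ge L0 Lt ta trg trag det1).
  have := gram_hyperbolic (det_theta a) ta (g_tw false).
  by rewrite !disc_det1 ?det_theta.
have v_neq0 : (xi1 (affine_act g pR), xi2 (affine_act g pR)) != (0, 0)%R.
  apply/eqP => -[v1 v2]; apply: gp; have := xi_inj _ v1 v2.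
  by rewrite affine_act_ratr => /map_mx_inj.
have [|a1 a1E [free loc]] := balanced_pingpong (@affine_act1 R) (@affine_actM R) _
  (trace_le_sqr_eigenvalue L0 L1 Lt ta) far aE gE det1 al_T de_T alde_T bega_T v_neq0.
  by rewrite (ler_int R 3).
have [Sa1 Sb1] := setpow_pingpong_pair Ssym S1 Sa Sg a1E.
exists (a1 ^+ 37)%g, (g * a1 ^+ 8 * g * a1 ^+ 37 * (g * a1 ^+ 8 * g)^-1)%g.
by split; [exact: Sa1|exact: Sb1|exact: free|exact: loc].
Qed.
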